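(* Let $P\in\mathbb{C}\{x,y\}$ with $P(0,0)=0$ and $P(0,y)\not\equiv0$, and suppose that $P$ has no zeros in $U\cap(\mathbb{R}\times(\mathbb{C}\setminus\mathbb{R}))$ for some neighborhood $U$ of $(0,0)$. Then, near $(0,0)$, the zero set of $P$ is a finite union of smooth curves $\{y=\phi(x)\}$ where each $\phi\in\mathbb{R}\{x\}$ is a convergent power series with real coefficients and $\phi(0)=0$; equivalently $P=u\prod_{j=1}^{M}(y-\phi_j(x))$ with $u$ a unit, $M=\mathrm{Ord}(P(0,y))$, and $\phi_j\in\mathbb{R}\{x\}$.
   Context: $\mathbb{C}\{x,y\}$ is the ring of convergent power series at the origin; $\mathbb{R}\{x\}$ denotes convergent power series in $x$ with real coefficients. A unit is a series not vanishing at the origin. Ord denotes order of vanishing at $0$. *)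

(* Defs.v *)
From Stdlib Require Import Reals List.
From Coquelicot Require Import Coquelicot.
Open Scope R_scope.

Definition CSeries (f : nat -> C) : C :=
  (Series (fun n => Re (f n)), Series (fun n => Im (f n))).

(* A two-variable power series sum_{i,j} a i j x^i y^j, coefficients a i j in C.
   It is convergent (an element of C{x,y}) if its coefficients satisfy a
   Cauchy bound |a i j| r^(i+j) <= K for some r > 0. *)
Definition conv2 (a : nat -> nat -> C) : Prop :=
  exists r K : R, 0 < r /\ forall i j, Cmod (a i j) * r ^ (i + j) <= K.

(* Value of the series at (x,y) (meaningful inside the polydisc of convergence). *)
Definition eval2 (a : nat -> nat -> C) (x y : C) : C :=
  CSeries (fun i => CSeries (fun j => a i j * Cpow x i * Cpow y j)%C).

Definition convR1 (b : nat -> R) : Prop :=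
  exists r K : R, 0 < r /\ forall n, Rabs (b n) * r ^ n <= K.

Definition evalR1 (b : nat -> R) (x : C) : C :=
  CSeries (fun n => (RtoC (b n) * Cpow x n)%C).

Definition Cprod (M : nat) (f : nat -> C) : C :=
  fold_right Cmult (RtoC 1) (map f (seq 0 M)).

(* Main.v *)
Require Import Defs.
From Stdlib Require Import Reals List.
From Coquelicot Require Import Coquelicot.
From Stdlib Require Import Lra Lia Arith Classical FunctionalExtensionality.
From mathcomp Require ssreflect ssrbool seq fintype bigop ssralg ssrnum complex Rstruct.
Import List.
Open Scope R_scope.

(** By Weierstrass preparation [P] is a unit times a monic polynomial [W] in [y] with analytic
    coefficients, all of whose roots are real for small real [x]. It remains to split such a [W],
    by induction on its degree [M]; by division it is enough to find one analytic root. After a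
    translation in [y] the roots have sum 0, so the sum of their squares is [-2 c2], where [c2] is
    the coefficient of [y^(M-2)]. If [c2 = 0] all roots vanish. Otherwise [c2 <= 0] on the real
    axis forces [c2 = x^(2m) g] with [g(0) <> 0]; all the roots are [O(x^m)] for real [x], so
    [y = x^m z] turns [W] into [x^(mM)] times a polynomial of the same kind, whose roots at
    [x = 0] are real, have sum 0 and are not all zero, hence not all equal. Weierstrass
    preparation at one of them lowers the degree. Analytic roots take real values on the real
    axis, so their coefficients are real. *)

(** The roots at a given [x] come as a list from the fundamental theorem of algebra, with no
    continuity in [x]; only their symmetric functions, which are coefficients, are handled as
    analytic functions. Reality turns one of these into a bound for all roots: squares of real
    numbers are nonnegative, so each root satisfies z^2 <= -2 c2. Reality on both sides of 0 also
    excludes an odd order of [c2], whose leading term would change sign; this is why no fractional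
    powers of [x] occur, in contrast to general Puiseux series. The bound on the roots makes the
    coefficient of [y^(M-k)] of size O(x^(mk)), so that the coefficients stay analytic after
    [y = x^m z]. At [x = 0] itself this substitution need not say anything about the roots, and
    their reality is recovered there by a limit argument. Germs are represented by functions
    [C -> C] that agree with a power series near 0, so that shifting, rescaling and evaluating
    polynomials are pointwise operations. *)

Lemma im_le_Cmod (z : C) : Rabs (Im z) <= Cmod z.
Proof. eapply Rle_trans; [|apply Rmax_Cmod]. apply Rmax_r. Qed.

Lemma Cmod_le_re_im (z : C) : Cmod z <= Rabs (Re z) + Rabs (Im z).
Proof.
  replace z with (RtoC (Re z) + Ci * RtoC (Im z))%C at 1.
  - eapply Rle_trans; [apply Cmod_triangle|].
    rewrite Cmod_mult, Cmod_Ci, !Cmod_R. lra.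
  - destruct z as [a b]. unfold Cplus, Cmult, Ci, RtoC; simpl. f_equal; ring.
Qed.

Lemma C_ext (z w : C) : Re z = Re w -> Im z = Im w -> z = w.
Proof. destruct z, w; simpl; intros; subst; reflexivity. Qed.

(** * Finite sums and Cauchy products *)

Fixpoint csum (f : nat -> C) (n : nat) : C :=
  match n with O => RtoC 0 | S n' => (csum f n' + f n')%C end.

Fixpoint rsum (f : nat -> R) (n : nat) : R :=
  match n with O => 0 | S n' => rsum f n' + f n' end.

Lemma csum_ext (f g : nat -> C) n : (forall k, (k < n)%nat -> f k = g k) -> csum f n = csum g n.
Proof.
  induction n; simpl; intros H; [reflexivity|].
  rewrite IHn, H; auto.
Qed.

Lemma csum_scal (c : C) f n : csum (fun k => c * f k)%C n = (c * csum f n)%C.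
Proof. induction n; simpl; [ring|]. rewrite IHn. ring. Qed.

Lemma csum_0 f n : (forall k, (k < n)%nat -> f k = RtoC 0) -> csum f n = RtoC 0.
Proof.
  induction n; simpl; intros H; [reflexivity|].
  rewrite IHn, H by auto. ring.
Qed.

Lemma Cmod_csum f n : Cmod (csum f n) <= rsum (fun k => Cmod (f k)) n.
Proof.
  induction n; simpl; [rewrite Cmod_0; lra|].
  eapply Rle_trans; [apply Cmod_triangle|]. lra.
Qed.

Lemma rsum_ext (f g : nat -> R) n : (forall k, (k < n)%nat -> f k = g k) -> rsum f n = rsum g n.
Proof.
  induction n; simpl; intros H; [reflexivity|].
  rewrite IHn, H; auto.
Qed.

Lemma rsum_le (f g : nat -> R) n : (forall k, (k < n)%nat -> f k <= g k) -> rsum f n <= rsum g n.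
Proof.
  induction n; simpl; intros H; [lra|].
  assert (f n <= g n) by auto. assert (rsum f n <= rsum g n) by auto. lra.
Qed.

Lemma rsum_scal c f n : rsum (fun k => c * f k) n = c * rsum f n.
Proof. induction n; simpl; [ring|]. rewrite IHn. ring. Qed.

Lemma rsum_plus f g n : rsum (fun k => f k + g k) n = rsum f n + rsum g n.
Proof. induction n; simpl; [ring|]. rewrite IHn. ring. Qed.

Lemma rsum_0 n : rsum (fun _ => 0) n = 0.
Proof. induction n; simpl; [ring|]. rewrite IHn. ring. Qed.

Lemma rsum_pos f n : (forall k, 0 <= f k) -> 0 <= rsum f n.
Proof. intros H; induction n; simpl; [lra|]. specialize (H n). lra. Qed.

Lemma rsum_term_le f n k : (forall k, 0 <= f k) -> (k < n)%nat -> f k <= rsum f n.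
Proof.
  intros H; induction n; simpl; intros Hk; [lia|].
  destruct (Nat.eq_dec k n) as [->|].
  - pose proof (rsum_pos f n H). lra.
  - specialize (H n). assert (f k <= rsum f n) by (apply IHn; lia). lra.
Qed.

Lemma rsum_S_sum_f_R0 f n : rsum f (S n) = sum_f_R0 f n.
Proof. induction n; [simpl; ring|]. change (rsum f (S n) + f (S n) = sum_f_R0 f (S n)). rewrite IHn. reflexivity. Qed.

Lemma csum_S_sum_f_R0 f n :
  csum f (S n) = (sum_f_R0 (fun k => Re (f k)) n, sum_f_R0 (fun k => Im (f k)) n).
Proof.
  induction n.
  - apply C_ext; unfold Re, Im; simpl; ring.
  - change (csum f (S n) + f (S n) = (sum_f_R0 (fun k => Re (f k)) (S n), sum_f_R0 (fun k => Im (f k)) (S n)))%C.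
    rewrite IHn. apply C_ext; reflexivity.
Qed.

(** The triangle of index pairs is summed by columns instead of rows: [a k] meets the first [N - k]
    values of [b]. *)
Lemma rsum_triangle a b N :
  rsum (fun n => rsum (fun k => a k * b (n - k)%nat) (S n)) N
  = rsum (fun k => a k * rsum b (N - k)) N.
Proof.
  induction N; [reflexivity|].
  change (rsum (fun n => rsum (fun k => a k * b (n - k)%nat) (S n)) N
    + rsum (fun k => a k * b (N - k)%nat) (S N) = rsum (fun k => a k * rsum b (S N - k)) (S N)).
  rewrite IHN.
  transitivity (rsum (fun k => a k * rsum b (N - k) + a k * b (N - k)%nat) (S N)).
  - rewrite rsum_plus. f_equal.
    change (rsum (fun k => a k * rsum b (N - k)) N =
            rsum (fun k => a k * rsum b (N - k)) N + a N * rsum b (N - N)).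
    rewrite Nat.sub_diag. simpl. ring.
  - apply rsum_ext; intros k Hk.
    replace (S N - k)%nat with (S (N - k)) by lia. simpl. ring.
Qed.

Lemma rsum_cauchy_le a b B N :
  (forall k, 0 <= a k) -> (forall n, rsum b n <= B) ->
  rsum (fun n => rsum (fun k => a k * b (n - k)%nat) (S n)) N <= rsum a N * B.
Proof.
  intros Ha Hb. rewrite rsum_triangle, Rmult_comm, <- rsum_scal.
  apply rsum_le; intros k _. rewrite (Rmult_comm B).
  apply Rmult_le_compat_l; auto.
Qed.

Definition cauchy_prod (f g : nat -> C) (n : nat) : C := csum (fun k => f k * g (n - k)%nat)%C (S n).

(** * Absolutely convergent complex series *)

(** Absolute convergence is part of the notion because Cauchy products rely on it; the sum is split
    into real and imaginary parts to match [CSeries]. *)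
Definition csums (f : nat -> C) (s : C) : Prop :=
  ex_series (fun n => Cmod (f n)) /\
  is_series (fun n => Re (f n)) (Re s) /\ is_series (fun n => Im (f n)) (Im s).

Lemma csums_unique f s : csums f s -> CSeries f = s.
Proof.
  intros (_ & H1 & H2). unfold CSeries.
  rewrite (is_series_unique _ _ H1), (is_series_unique _ _ H2). now destruct s.
Qed.

Lemma csums_CSeries f : ex_series (fun n => Cmod (f n)) -> csums f (CSeries f).
Proof.
  intros H. split; [exact H|]. unfold CSeries; simpl.
  split; apply Series_correct; refine (@ex_series_le R_AbsRing R_CompleteNormedModule _ _ _ H);
    intros n; [apply re_le_Cmod|apply im_le_Cmod].
Qed.

Lemma csums_ext f g s : (forall n, f n = g n) -> csums f s -> csums g s.
Proof.
  intros E H. replace g with f; [exact H|]. now apply functional_extensionality.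
Qed.

Lemma csums_plus f g s t : csums f s -> csums g t -> csums (fun n => f n + g n)%C (s + t)%C.
Proof.
  intros (F1 & F2 & F3) (G1 & G2 & G3). split; [|split].
  - eapply (@ex_series_le R_AbsRing R_CompleteNormedModule).
    2: { apply (ex_series_plus _ _ F1 G1). }
    intros n. change (Rabs (Cmod (f n + g n)) <= Cmod (f n) + Cmod (g n)).
    rewrite Rabs_pos_eq by apply Cmod_ge_0. apply Cmod_triangle.
  - apply (is_series_plus _ _ _ _ F2 G2).
  - apply (is_series_plus _ _ _ _ F3 G3).
Qed.

Lemma csums_scal c f s : csums f s -> csums (fun n => c * f n)%C (c * s)%C.
Proof.
  intros (F1 & F2 & F3). split; [|split].
  - eapply ex_series_ext; [|apply (ex_series_scal (Cmod c) _ F1)].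
    intros n. symmetry. apply Cmod_mult.
  - eapply is_series_ext; [|apply (is_series_minus _ _ _ _ (is_series_scal (Re c) _ _ F2)
       (is_series_scal (Im c) _ _ F3))]. intros n; reflexivity.
  - eapply is_series_ext; [|apply (is_series_plus _ _ _ _ (is_series_scal (Re c) _ _ F3)
       (is_series_scal (Im c) _ _ F2))]. intros n; reflexivity.
Qed.

Lemma csums_0 : csums (fun _ => RtoC 0) (RtoC 0).
Proof.
  assert (H : is_series (fun _ : nat => 0) 0).
  { eapply is_series_ext; [|replace 0 with (0 * / (1 - 0)) by ring;
      apply (is_series_scal_l 0 _ _ (is_series_geom 0 ltac:(rewrite Rabs_R0; lra)))].
    intros n. apply Rmult_0_l. }
  split; [|split]; simpl; try exact H.
  exists 0. eapply is_series_ext; [|exact H]. intros n. now rewrite Cmod_0.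
Qed.

Lemma csums_cons f s : csums (fun n => f (S n)) s -> csums f (f O + s)%C.
Proof.
  intros (F1 & F2 & F3). split; [|split].
  - now apply ex_series_incr_1.
  - apply is_series_decr_1.
    replace (plus _ _) with (Re s) by (unfold plus, opp, Re, Im; simpl; ring). exact F2.
  - apply is_series_decr_1.
    replace (plus _ _) with (Im s) by (unfold plus, opp, Re, Im; simpl; ring). exact F3.
Qed.

Lemma csums_csum (f : nat -> nat -> C) (s : nat -> C) m :
  (forall i, (i < m)%nat -> csums (f i) (s i)) ->
  csums (fun n => csum (fun i => f i n) m) (csum s m).
Proof.
  induction m; intros H; simpl; [apply csums_0|].
  apply csums_plus; auto.
Qed.

Lemma csums_mult f g s t : csums f s -> csums g t -> csums (cauchy_prod f g) (s * t)%C.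
Proof.
  intros (F1 & F2 & F3) (G1 & G2 & G3).
  assert (AR : forall h, ex_series (fun n => Cmod (h n)) -> ex_series (fun n => Rabs (Re (h n)))).
  { intros h. apply (@ex_series_le R_AbsRing R_CompleteNormedModule).
    intros n. change (Rabs (Rabs (Re (h n))) <= Cmod (h n)).
    rewrite Rabs_Rabsolu. apply re_le_Cmod. }
  assert (AI : forall h, ex_series (fun n => Cmod (h n)) -> ex_series (fun n => Rabs (Im (h n)))).
  { intros h. apply (@ex_series_le R_AbsRing R_CompleteNormedModule).
    intros n. change (Rabs (Rabs (Im (h n))) <= Cmod (h n)).
    rewrite Rabs_Rabsolu. apply im_le_Cmod. }
  split; [|split].
  - destruct F1 as [a F1], G1 as [b G1].
    pose proof (is_series_mult_pos _ _ _ _ F1 G1 (fun n => Cmod_ge_0 _) (fun n => Cmod_ge_0 _)) as H.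
    eapply (@ex_series_le R_AbsRing R_CompleteNormedModule); [|exists (a * b); exact H].
    intros n. change (Rabs (Cmod (cauchy_prod f g n)) <=
      sum_f_R0 (fun k => Cmod (f k) * Cmod (g (n - k)%nat)) n).
    rewrite Rabs_pos_eq by apply Cmod_ge_0.
    unfold cauchy_prod. eapply Rle_trans; [apply Cmod_csum|].
    rewrite rsum_S_sum_f_R0. apply Req_le, sum_eq. intros k _. apply Cmod_mult.
  - pose proof (is_series_minus _ _ _ _
      (is_series_mult _ _ _ _ F2 G2 (AR _ F1) (AR _ G1))
      (is_series_mult _ _ _ _ F3 G3 (AI _ F1) (AI _ G1))) as H.
    eapply is_series_ext; [|exact H].
    intros n. unfold cauchy_prod. rewrite csum_S_sum_f_R0. 
    symmetry. etransitivity; [|exact (minus_sum _ _ n)]. reflexivity.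
  - pose proof (is_series_plus _ _ _ _
      (is_series_mult _ _ _ _ F2 G3 (AR _ F1) (AI _ G1))
      (is_series_mult _ _ _ _ F3 G2 (AI _ F1) (AR _ G1))) as H.
    eapply is_series_ext; [|exact H].
    intros n. unfold cauchy_prod. rewrite csum_S_sum_f_R0. 
    symmetry. etransitivity; [|exact (sum_plus _ _ n)]. reflexivity.
Qed.

(** The factor 2 comes from estimating the real and the imaginary part separately, each by the
    geometric series. *)
Lemma csums_geom_bound f K q :
  0 <= q < 1 -> (forall n, Cmod (f n) <= K * q ^ n) ->
  csums f (CSeries f) /\ Cmod (CSeries f) <= 2 * (K / (1 - q)).
Proof.
  intros Hq Hf.
  assert (G : is_series (fun n => K * q ^ n) (K / (1 - q))).
  { apply (is_series_scal_l (V := R_NormedModule) K (fun n => q ^ n) (/ (1 - q))).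
    apply is_series_geom. rewrite Rabs_pos_eq; lra. }
  assert (E : ex_series (fun n => Cmod (f n))).
  { eapply (@ex_series_le R_AbsRing R_CompleteNormedModule); [|exists (K / (1 - q)); exact G].
    intros n. change (Rabs (Cmod (f n)) <= K * q ^ n).
    rewrite Rabs_pos_eq by apply Cmod_ge_0. apply Hf. }
  split; [now apply csums_CSeries|].
  eapply Rle_trans; [apply Cmod_le_re_im|].
  assert (B : forall h : nat -> R, (forall n, Rabs (h n) <= Cmod (f n)) -> Rabs (Series h) <= K / (1 - q)).
  { intros h Hh. eapply Rle_trans; [apply Series_Rabs|].
    - eapply (@ex_series_le R_AbsRing R_CompleteNormedModule); [|exact E].
      intros n. change (Rabs (Rabs (h n)) <= Cmod (f n)). rewrite Rabs_Rabsolu. apply Hh.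
    - rewrite <- (is_series_unique _ _ G). apply Series_le; [|eexists; exact G].
      intros n. split; [apply Rabs_pos|]. eapply Rle_trans; [apply Hh|apply Hf]. }
  unfold CSeries; simpl.
  pose proof (B (fun n => Re (f n)) (fun n => re_le_Cmod _)).
  pose proof (B (fun n => Im (f n)) (fun n => im_le_Cmod _)). lra.
Qed.

Lemma csums_terms_bounded f s : csums f s -> exists K, 0 < K /\ forall n, Cmod (f n) <= K.
Proof.
  intros ((l & H) & _).
  assert (P : forall n, rsum (fun k => Cmod (f k)) n <= l).
  { intros n. eapply Rle_trans with (rsum (fun k => Cmod (f k)) (S n)).
    - simpl. pose proof (Cmod_ge_0 (f n)). lra.
    - rewrite rsum_S_sum_f_R0, <- sum_n_Reals.
      apply (is_lim_seq_incr_compare _ _ H).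
      intros k. rewrite sum_Sn. unfold plus; simpl. pose proof (Cmod_ge_0 (f (S k))). lra. }
  exists (Rabs l + 1). split; [pose proof (Rabs_pos l); lra|]. intros n.
  pose proof (rsum_term_le (fun k => Cmod (f k)) (S n) n (fun k => Cmod_ge_0 _) ltac:(lia)).
  specialize (P (S n)). pose proof (Rle_abs l). lra.
Qed.

(** * Germs of analytic functions *)

Definition near (P : C -> Prop) : Prop := exists d, 0 < d /\ forall x, Cmod x < d -> P x.

Lemma near_and P Q : near P -> near Q -> near (fun x => P x /\ Q x).
Proof.
  intros (d & Hd & H) (e & He & H'). exists (Rmin d e). split; [now apply Rmin_pos|].
  intros x Hx. split; [apply H|apply H'];
    (eapply Rlt_le_trans; [exact Hx|]); [apply Rmin_l|apply Rmin_r].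
Qed.

Lemma near_mono (P Q : C -> Prop) : (forall x, P x -> Q x) -> near P -> near Q.
Proof. intros PQ (d & Hd & H). exists d. split; auto. Qed.

Lemma near_all (P : C -> Prop) : (forall x, P x) -> near P.
Proof. intros H. exists 1. split; [lra|auto]. Qed.

Lemma near_ball d : 0 < d -> near (fun x => Cmod x < d).
Proof. intros H. exists d. auto. Qed.

Lemma near_at_0 P : near P -> P (RtoC 0).
Proof. intros (d & Hd & H). apply H. now rewrite Cmod_0. Qed.

(** The function is tied to the series only near 0 and is arbitrary elsewhere, which is why
    identities coming from series hold under [near]. *)
Definition has_series (b : nat -> C) (f : C -> C) : Prop :=
  near (fun x => csums (fun n => b n * x ^ n)%C (f x)).

Definition analytic (f : C -> C) : Prop := exists b, has_series b f.

Lemma csums_cons' f s t : t = (f O + s)%C -> csums (fun n => f (S n)) s -> csums f t.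
Proof. intros ->. apply csums_cons. Qed.

Lemma has_series_0 b f : has_series b f -> f (RtoC 0) = b O.
Proof.
  intros H. pose proof (csums_unique _ _ (near_at_0 _ H)) as E. rewrite <- E.
  apply csums_unique.
  replace (b O) with (b O * Cpow (RtoC 0) 0 + RtoC 0)%C at 1 by (simpl; ring).
  apply (csums_cons (fun n => b n * Cpow (RtoC 0) n)%C).
  eapply csums_ext; [|apply csums_0]. intros n. simpl. ring.
Qed.

Lemma has_series_of_bound b r K : 0 < r -> (forall n, Cmod (b n) * r ^ n <= K) ->
  forall x, Cmod x < r -> csums (fun n => b n * x ^ n)%C (CSeries (fun n => b n * x ^ n)%C).
Proof.
  intros Hr Hb x Hx. pose proof (Cmod_ge_0 x).
  apply (csums_geom_bound _ K (Cmod x / r)).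
  - split; [apply Rdiv_le_0_compat; lra|]. apply Rmult_lt_reg_r with r; [lra|].
    unfold Rdiv. rewrite Rmult_assoc, Rinv_l; lra.
  - intros n. rewrite Cmod_mult, Cmod_pow. unfold Rdiv. rewrite Rpow_mult_distr, pow_inv.
    assert (0 < r ^ n) by now apply pow_lt.
    replace (Cmod (b n) * Cmod x ^ n) with (Cmod (b n) * r ^ n * (Cmod x ^ n * / r ^ n)) by (field; lra).
    apply Rmult_le_compat_r; [|apply Hb].
    apply Rmult_le_pos; [now apply pow_le|]. left. now apply Rinv_0_lt_compat.
Qed.

(** Convergence at the single point [d / 2] already bounds the terms there, which is a Cauchy
    estimate. *)
Lemma has_series_bound b f : has_series b f ->
  exists r K, 0 < r /\ 0 < K /\ forall n, Cmod (b n) * r ^ n <= K.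
Proof.
  intros (d & Hd & H). specialize (H (RtoC (d / 2))).
  rewrite Cmod_R, Rabs_pos_eq in H by lra.
  destruct (csums_terms_bounded _ _ (H ltac:(lra))) as (K & HK & B).
  exists (d / 2), K. split; [lra|split; [exact HK|]]. intros n. specialize (B n).
  rewrite Cmod_mult, Cmod_pow, Cmod_R, Rabs_pos_eq in B by lra. exact B.
Qed.

Lemma has_series_bounded b f : has_series b f -> exists K, 0 < K /\ near (fun x => Cmod (f x) <= K).
Proof.
  intros H. destruct (has_series_bound _ _ H) as (r & K & Hr & HK & B).
  exists (2 * (K / (1 - / 2))). split; [lra|].
  refine (near_mono _ _ _ (near_and _ _ H (near_ball (r / 2) ltac:(lra)))).
  intros x [Hx Hxr]. rewrite <- (csums_unique _ _ Hx).
  apply csums_geom_bound; [lra|]. intros n. rewrite Cmod_mult, Cmod_pow.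
  eapply Rle_trans with (Cmod (b n) * (r / 2) ^ n).
  - apply Rmult_le_compat_l; [apply Cmod_ge_0|]. apply pow_incr. split; [apply Cmod_ge_0|lra].
  - unfold Rdiv. rewrite Rpow_mult_distr, <- Rmult_assoc.
    apply Rmult_le_compat_r; [apply pow_le; lra|apply B].
Qed.

(** Dropping the constant coefficient divides the Cauchy bound by [r] and keeps the radius.
    Continuity, orders of vanishing and uniqueness of coefficients all rest on this division. *)
Lemma has_series_div_x b f : has_series b f ->
  exists g, has_series (fun n => b (S n)) g /\ near (fun x => f x = f (RtoC 0) + x * g x)%C.
Proof.
  intros H. destruct (has_series_bound _ _ H) as (r & K & Hr & HK & B).
  assert (HB : forall n, Cmod (b (S n)) * r ^ n <= K / r).
  { intros n. apply Rmult_le_reg_r with r; [lra|].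
    replace (K / r * r) with K by (field; lra).
    specialize (B (S n)). simpl in B. lra. }
  exists (fun x => CSeries (fun n => b (S n) * x ^ n)%C).
  assert (G := has_series_of_bound _ _ _ Hr HB).
  split; [exists r; auto|].
  refine (near_mono _ _ _ (near_and _ _ H (near_ball r Hr))).
  intros x [Hx Hxr]. rewrite <- (csums_unique _ _ Hx). apply csums_unique.
  rewrite (has_series_0 _ _ H).
  replace (b O) with (b O * x ^ 0)%C by (simpl; ring).
  apply (csums_cons (fun n => b n * x ^ n)%C).
  eapply csums_ext; [|apply (csums_scal x _ _ (G x Hxr))].
  intros n. simpl. ring.
Qed.

Lemma has_series_continuous b f : has_series b f -> forall e, 0 < e ->
  near (fun x => Cmod (f x - f (RtoC 0))%C < e).
Proof.
  intros H e He. destruct (has_series_div_x _ _ H) as (g & Hg & E).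
  destruct (has_series_bounded _ _ Hg) as (K & HK & B).
  assert (D : 0 < e / K) by now apply Rdiv_lt_0_compat.
  refine (near_mono _ _ _ (near_and _ _ (near_and _ _ E B) (near_ball _ D))).
  intros x [[-> Hx] Hd].
  replace (f (RtoC 0) + x * g x - f (RtoC 0))%C with (x * g x)%C by ring.
  rewrite Cmod_mult. apply Rle_lt_trans with (Cmod x * K).
  - apply Rmult_le_compat_l; [apply Cmod_ge_0|exact Hx].
  - apply Rmult_lt_reg_r with (/ K); [now apply Rinv_0_lt_compat|].
    rewrite Rmult_assoc, Rinv_r; [|lra]. unfold Rdiv in Hd. lra.
Qed.

Lemma analytic_continuous f : analytic f -> forall e, 0 < e ->
  near (fun x => Cmod (f x - f (RtoC 0))%C < e).
Proof. intros [b H]. eapply has_series_continuous; eauto. Qed.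

Lemma analytic_nonzero f : analytic f -> f (RtoC 0) <> RtoC 0 -> near (fun x => f x <> RtoC 0).
Proof.
  intros H N. assert (P : 0 < Cmod (f (RtoC 0))) by now apply Cmod_gt_0.
  refine (near_mono _ _ _ (analytic_continuous _ H _ P)).
  intros x Hx E. rewrite E in Hx.
  replace (RtoC 0 - f (RtoC 0))%C with (- f (RtoC 0))%C in Hx by ring.
  rewrite Cmod_opp in Hx. lra.
Qed.

Lemma has_series_plus b c f g : has_series b f -> has_series c g ->
  has_series (fun n => b n + c n)%C (fun x => f x + g x)%C.
Proof.
  intros H H'. refine (near_mono _ _ _ (near_and _ _ H H')).
  intros x [F G]. eapply csums_ext; [|exact (csums_plus _ _ _ _ F G)].
  intros n. simpl. ring.
Qed.

Lemma cauchy_pow (b c : nat -> C) (x : C) (n : nat) :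
  cauchy_prod (fun k => b k * x ^ k)%C (fun k => c k * x ^ k)%C n = (cauchy_prod b c n * x ^ n)%C.
Proof.
  unfold cauchy_prod. rewrite (Cmult_comm (csum _ _)), <- csum_scal. apply csum_ext. intros k Hk.
  replace (x ^ n)%C with (x ^ k * x ^ (n - k))%C; [ring|].
  rewrite <- Cpow_add_r. f_equal. lia.
Qed.

Lemma has_series_mult b c f g : has_series b f -> has_series c g ->
  has_series (cauchy_prod b c) (fun x => f x * g x)%C.
Proof.
  intros H H'. refine (near_mono _ _ _ (near_and _ _ H H')).
  intros x [F G]. eapply csums_ext; [|exact (csums_mult _ _ _ _ F G)].
  intros n. apply cauchy_pow.
Qed.

Lemma analytic_const c : analytic (fun _ => c).
Proof.
  exists (fun n => match n with O => c | _ => RtoC 0 end). apply near_all. intros x.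
  eapply csums_cons'; [|eapply csums_ext; [|apply csums_0]]; intros; simpl; ring.
Qed.

Lemma analytic_plus f g : analytic f -> analytic g -> analytic (fun x => f x + g x)%C.
Proof. intros [b H] [c H']. eexists. eapply has_series_plus; eauto. Qed.

Lemma analytic_mult f g : analytic f -> analytic g -> analytic (fun x => f x * g x)%C.
Proof. intros [b H] [c H']. eexists. eapply has_series_mult; eauto. Qed.

Lemma analytic_id : analytic (fun x => x).
Proof.
  exists (fun n => match n with 1%nat => RtoC 1 | _ => RtoC 0 end). apply near_all. intros x.
  eapply csums_cons'; [|eapply csums_cons'; [reflexivity|eapply csums_ext; [|apply csums_0]]];
    intros; simpl; ring.
Qed.

Lemma analytic_pow n : analytic (fun x => x ^ n)%C.
Proof.
  induction n; simpl; [apply analytic_const|].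
  apply analytic_mult; [apply analytic_id|exact IHn].
Qed.

Lemma has_series_div_pow n : forall b f, has_series b f -> (forall i, (i < n)%nat -> b i = RtoC 0) ->
  exists g, has_series (fun k => b (n + k)%nat) g /\ near (fun x => f x = x ^ n * g x)%C.
Proof.
  induction n; intros b f H Z.
  - exists f. split; [exact H|]. apply near_all. intros x. simpl. ring.
  - destruct (has_series_div_x _ _ H) as (g & Hg & E).
    destruct (IHn _ _ Hg) as (h & Hh & E'). { intros i Hi. apply Z. lia. }
    exists h. split; [exact Hh|]. refine (near_mono _ _ _ (near_and _ _ E E')).
    intros x [-> ->]. rewrite (has_series_0 _ _ H), Z by lia. simpl. ring.
Qed.

Lemma analytic_order f : analytic f ->
  near (fun x => f x = RtoC 0) \/
  exists n g, analytic g /\ g (RtoC 0) <> RtoC 0 /\ near (fun x => f x = x ^ n * g x)%C.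
Proof.
  intros [b H]. destruct (classic (exists n, b n <> RtoC 0)) as [N|N].
  - right. destruct (dec_inh_nat_subset_has_unique_least_element _ (fun n => classic _) N)
      as (n & [Hn Hmin] & _).
    destruct (has_series_div_pow n _ _ H) as (g & Hg & E).
    + intros i Hi. apply NNPP. intros C. specialize (Hmin _ C). lia.
    + exists n, g. split; [eexists; eauto|]. split; [|exact E].
      rewrite (has_series_0 _ _ Hg), Nat.add_0_r. exact Hn.
  - left. refine (near_mono _ _ _ H). intros x Hx.
    rewrite <- (csums_unique _ _ Hx). apply csums_unique.
    eapply csums_ext; [|apply csums_0]. intros n. simpl.
    replace (b n) with (RtoC 0); [ring|]. apply NNPP. intros C. apply N. exists n. auto.
Qed.

(** * Behaviour on the positive real axis *)

Definition near_pos (P : R -> Prop) : Prop := exists d, 0 < d /\ forall t, 0 < t < d -> P t.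

Lemma near_near_pos P : near P -> near_pos (fun t => P (RtoC t)).
Proof.
  intros (d & Hd & H). exists d. split; [exact Hd|]. intros t Ht. apply H.
  rewrite Cmod_R, Rabs_pos_eq; lra.
Qed.

Lemma near_pos_and P Q : near_pos P -> near_pos Q -> near_pos (fun x => P x /\ Q x).
Proof.
  intros (d & Hd & H) (e & He & H'). exists (Rmin d e). split; [now apply Rmin_pos|].
  intros x Hx. pose proof (Rmin_l d e). pose proof (Rmin_r d e).
  split; [apply H|apply H']; lra.
Qed.

Lemma near_pos_inhab P : near_pos P -> exists t, 0 < t /\ P t.
Proof. intros (d & Hd & H). exists (d / 2). split; [lra|apply H; lra]. Qed.

Lemma near_pos_mono (P Q : R -> Prop) : (forall x, 0 < x -> P x -> Q x) -> near_pos P -> near_pos Q.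
Proof. intros PQ (d & Hd & H). exists d. split; [auto|]. intros t Ht. apply PQ; [lra|auto]. Qed.

(** Otherwise [f] would be [x ^ n] times a function without zeros near 0, hence nonzero at every
    small positive real. *)
Lemma analytic_identity f : analytic f -> near_pos (fun t => f (RtoC t) = RtoC 0) ->
  near (fun x => f x = RtoC 0).
Proof.
  intros H Z. destruct (analytic_order _ H) as [|(n & g & Hg & N & E)]; [assumption|exfalso].
  pose proof (analytic_nonzero _ Hg N) as G.
  destruct (near_pos_inhab _ (near_pos_and _ _ Z (near_near_pos _ (near_and _ _ E G)))) as (t & Ht & Z' & E' & G').
  rewrite Z' in E'. symmetry in E'. revert E'. apply Cmult_neq_0; [|exact G'].
  apply Cpow_nz. intros C. apply RtoC_inj in C. lra.
Qed.

(** Once the coefficients below [n] are zero, [x ^ n] can be divided out; the quotient has the value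
    [b n] at 0 and still vanishes on the positive axis. *)
Lemma has_series_zero b f : has_series b f -> near_pos (fun t => f (RtoC t) = RtoC 0) ->
  forall n, b n = RtoC 0.
Proof.
  intros H Z n. induction n as [n IH] using lt_wf_ind.
  destruct (has_series_div_pow n _ _ H IH) as (g & Hg & E).
  assert (N : near (fun x => g x = RtoC 0)).
  { apply analytic_identity; [eexists; eauto|].
    refine (near_pos_mono _ _ _ (near_pos_and _ _ Z (near_near_pos _ E))).
    intros t Ht [Z' E']. rewrite Z' in E'. apply NNPP. intros C.
    symmetry in E'. revert E'. apply Cmult_neq_0; [|exact C].
    apply Cpow_nz. intros C'. apply RtoC_inj in C'. lra. }
  apply near_at_0 in N. rewrite (has_series_0 _ _ Hg), Nat.add_0_r in N. exact N.
Qed.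

(* The imaginary parts of the coefficients are the coefficients of a series that vanishes on the
   real axis. *)
Lemma analytic_real f : analytic f -> near_pos (fun t => Im (f (RtoC t)) = 0) ->
  exists b, convR1 b /\ near (fun x => f x = evalR1 b x).
Proof.
  intros [b H] Z. destruct (has_series_bound _ _ H) as (r & K & Hr & HK & B).
  assert (BI : forall n, Cmod (RtoC (Im (b n))) * r ^ n <= K).
  { intros n. rewrite Cmod_R. eapply Rle_trans; [|apply (B n)].
    apply Rmult_le_compat_r; [apply pow_le; lra|apply im_le_Cmod]. }
  pose proof (has_series_of_bound _ _ _ Hr BI) as HI.
  assert (I0 : forall n, RtoC (Im (b n)) = RtoC 0).
  { apply (has_series_zero _ (fun x => CSeries (fun n => RtoC (Im (b n)) * x ^ n)%C)).
    - exists r. auto.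
    - refine (near_pos_mono _ _ _ (near_pos_and _ _ Z (near_near_pos _ H))).
      intros t Ht [Zt (_ & _ & Hx)]. rewrite Zt in Hx.
      apply C_ext.
      + transitivity (Series (fun n => Im (b n * RtoC t ^ n)%C)).
        * apply Series_ext. intros n. now rewrite <- RtoC_pow, re_scal_l, re_RtoC, im_scal_r.
        * now apply is_series_unique.
      + transitivity (Series (fun _ => 0)).
        * apply Series_ext. intros n. now rewrite <- RtoC_pow, <- RtoC_mult, im_RtoC.
        * destruct csums_0 as (_ & _ & H0). now apply is_series_unique. }
  exists (fun n => Re (b n)). split.
  - exists r, K. split; [exact Hr|]. intros n. eapply Rle_trans; [|apply (B n)].
    apply Rmult_le_compat_r; [apply pow_le; lra|apply re_le_Cmod].
  - refine (near_mono _ _ _ H). intros x Hx. unfold evalR1.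
    rewrite <- (csums_unique _ _ Hx). f_equal. apply functional_extensionality. intros n.
    f_equal. apply C_ext; [reflexivity|]. rewrite im_RtoC. now apply RtoC_inj.
Qed.

(** * Weierstrass preparation *)

(** Course-of-values recursion, for quotients whose next coefficient or row depends on all earlier
    ones. In the proof [pre n] is a table of the first [n] values, filled with [d] beyond them. *)
Lemma strong_recursion {A : Type} (d : A) (Phi : nat -> (nat -> A) -> A) :
  (forall n f g, (forall i, (i < n)%nat -> f i = g i) -> Phi n f = Phi n g) ->
  {f : nat -> A | forall n, f n = Phi n f}.
Proof.
  intros ext.
  set (pre := fix pre n : nat -> A := match n with
    | O => fun _ => d
    | S n' => fun i => if Nat.eqb i n' then Phi n' (pre n') else pre n' i end).
  assert (P : forall n m, (n < m)%nat -> pre m n = Phi n (pre n)).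
  { intros n m. induction m; intros H; [lia|]. simpl.
    destruct (Nat.eqb_spec n m) as [->|]; [reflexivity|]. apply IHm. lia. }
  exists (fun n => pre (S n) n). intros n. rewrite P by lia. apply ext.
  intros i Hi. rewrite !P by lia. reflexivity.
Qed.

(** A weighted l1 norm, bounded through its partial sums so that no summability has to be carried
    along. It is submultiplicative for [cauchy_prod], so each row of a two-variable series can be
    estimated as one object. *)
Definition norm_le (s : R) (f : nat -> C) (B : R) : Prop :=
  forall N, rsum (fun j => Cmod (f j) * s ^ j) N <= B.

Lemma wt_pos s (f : nat -> C) j : 0 < s -> 0 <= Cmod (f j) * s ^ j.
Proof. intros. apply Rmult_le_pos; [apply Cmod_ge_0|apply pow_le; lra]. Qed.

Lemma norm_le_term s f B j : 0 < s -> norm_le s f B -> Cmod (f j) * s ^ j <= B.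
Proof.
  intros Hs H. eapply Rle_trans; [|apply (H (S j))].
  apply (rsum_term_le (fun j => Cmod (f j) * s ^ j)); [intros; now apply wt_pos|lia].
Qed.

Lemma norm_le_plus s f g A B : 0 < s -> norm_le s f A -> norm_le s g B ->
  norm_le s (fun j => f j + g j)%C (A + B).
Proof.
  intros Hs F G N. eapply Rle_trans; [|apply Rplus_le_compat; [apply (F N)|apply (G N)]].
  rewrite <- rsum_plus. apply rsum_le. intros j _. rewrite <- Rmult_plus_distr_r.
  apply Rmult_le_compat_r; [apply pow_le; lra|apply Cmod_triangle].
Qed.

Lemma norm_le_opp s f A : norm_le s f A -> norm_le s (fun j => - f j)%C A.
Proof.
  intros F N. eapply Rle_trans; [|apply (F N)]. apply Req_le, rsum_ext.
  intros. now rewrite Cmod_opp.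
Qed.

Lemma norm_le_csum s (f : nat -> nat -> C) (B : nat -> R) n : 0 < s ->
  (forall i, (i < n)%nat -> norm_le s (f i) (B i)) ->
  norm_le s (fun j => csum (fun i => f i j) n) (rsum B n).
Proof.
  intros Hs. induction n; intros H; simpl.
  - intros N. rewrite (rsum_ext _ (fun _ => 0)), rsum_0; [lra|].
    intros. rewrite Cmod_0. ring.
  - apply norm_le_plus; auto.
Qed.

Lemma Cmod_cauchy_prod_le s f g n : 0 < s ->
  Cmod (cauchy_prod f g n) * s ^ n <=
  rsum (fun k => Cmod (f k) * s ^ k * (Cmod (g (n - k)%nat) * s ^ (n - k))) (S n).
Proof.
  intros Hs. unfold cauchy_prod. eapply Rle_trans.
  - apply Rmult_le_compat_r; [apply pow_le; lra|apply Cmod_csum].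
  - rewrite Rmult_comm, <- rsum_scal. apply Req_le, rsum_ext. intros k Hk.
    rewrite Cmod_mult. replace (s ^ n) with (s ^ k * s ^ (n - k)); [ring|].
    rewrite <- pow_add. f_equal. lia.
Qed.

Lemma norm_le_cauchy_prod s f g A B : 0 < s -> 0 <= B -> norm_le s f A -> norm_le s g B ->
  norm_le s (cauchy_prod f g) (A * B).
Proof.
  intros Hs HB F G N.
  eapply Rle_trans; [apply rsum_le; intros; now apply Cmod_cauchy_prod_le|].
  eapply Rle_trans.
  - apply (rsum_cauchy_le (fun k => Cmod (f k) * s ^ k) (fun k => Cmod (g k) * s ^ k) B);
      [intros; now apply wt_pos|exact G].
  - apply Rmult_le_compat_r; [exact HB|apply F].
Qed.

Lemma rsum_split f m n : rsum f (m + n) = rsum f m + rsum (fun j => f (m + j)%nat) n.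
Proof.
  induction n; simpl; [rewrite Nat.add_0_r; ring|].
  rewrite Nat.add_succ_r. simpl. rewrite IHn. ring.
Qed.

Lemma csum_split f m n : csum f (m + n) = (csum f m + csum (fun j => f (m + j)%nat) n)%C.
Proof.
  induction n; simpl; [rewrite Nat.add_0_r; ring|].
  rewrite Nat.add_succ_r. simpl. rewrite IHn. ring.
Qed.

Lemma norm_le_shift s f B m : 0 < s -> norm_le s f B -> norm_le s (fun j => f (m + j)%nat) (B / s ^ m).
Proof.
  intros Hs F N. assert (Hm : 0 < s ^ m) by now apply pow_lt.
  apply Rmult_le_reg_r with (s ^ m); [exact Hm|].
  replace (B / s ^ m * s ^ m) with B by (field; lra).
  eapply Rle_trans; [|apply (F (m + N)%nat)].
  rewrite rsum_split, Rmult_comm, <- rsum_scal.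
  pose proof (rsum_pos (fun j => Cmod (f j) * s ^ j) m (fun j => wt_pos s f j Hs)).
  rewrite (rsum_ext _ (fun j => Cmod (f (m + j)%nat) * s ^ (m + j))); [lra|].
  intros. rewrite pow_add. ring.
Qed.

(** In the weighted norm the tail of [e] is at most half of the constant term, so dividing by [e]
    costs at most the factor [2 / Cmod (e O)]. The quotient comes in a [sig] type so that it can be
    extracted as a function of [g] inside a later recursion. *)
Lemma unit_division (e : nat -> C) (s : R) : e O <> RtoC 0 -> 0 < s ->
  (forall N, rsum (fun j => Cmod (e (S j)) * s ^ S j) N <= Cmod (e O) / 2) ->
  forall g, {q | (forall j, cauchy_prod q e j = g j) /\
    forall B, norm_le s g B -> norm_le s q (2 / Cmod (e O) * B)}.
Proof.
  intros He Hs Hsmall g. assert (He' : 0 < Cmod (e O)) by now apply Cmod_gt_0.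
  destruct (strong_recursion (RtoC 0)
    (fun n f => (g n - csum (fun k => f k * e (n - k)%nat) n) / e O)%C) as [q Hq].
  { intros n f h E. f_equal. f_equal. apply csum_ext. intros k Hk. now rewrite E. }
  exists q. split.
  - intros j. unfold cauchy_prod. simpl. rewrite Nat.sub_diag, (Hq j). now field.
  - intros B HB N.
    set (a := fun k => Cmod (q k) * s ^ k).
    (* [b] is the tail of [e]: with 0 in place of the constant term, the term [k = n] drops out of
       the convolution. *)
    set (b := fun k => match k with O => 0 | _ => Cmod (e k) * s ^ k end).
    assert (Hb : forall n, rsum b n <= Cmod (e O) / 2).
    { intros [|n]; [simpl; lra|].
      change (S n) with (1 + n)%nat. rewrite rsum_split. simpl. rewrite !Rplus_0_l. apply Hsmall. }
    assert (Ha : forall k, 0 <= a k) by (intros; now apply wt_pos).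
    assert (T : forall n, Cmod (e O) * a n <= Cmod (g n) * s ^ n + rsum (fun k => a k * b (n - k)%nat) (S n)).
    { intros n. unfold a at 1. rewrite <- Rmult_assoc, <- Cmod_mult, (Hq n).
      replace (e O * ((g n - csum (fun k => q k * e (n - k)%nat) n) / e O))%C
        with (g n + - csum (fun k => q k * e (n - k)%nat) n)%C by now field.
      eapply Rle_trans; [apply Rmult_le_compat_r; [apply pow_le; lra|apply Cmod_triangle]|].
      rewrite Cmod_opp, Rmult_plus_distr_r. apply Rplus_le_compat_l.
      simpl. rewrite Nat.sub_diag. simpl. rewrite Rmult_0_r, Rplus_0_r.
      eapply Rle_trans; [apply Rmult_le_compat_r; [apply pow_le; lra|apply Cmod_csum]|].
      rewrite Rmult_comm, <- rsum_scal. apply Req_le, rsum_ext. intros k Hk.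
      rewrite Cmod_mult. unfold a, b. destruct (n - k)%nat as [|m] eqn:Em; [lia|].
      rewrite <- Em. replace (s ^ n) with (s ^ k * s ^ (n - k)); [ring|].
      rewrite <- pow_add. f_equal. lia. }
    (* Half of the left side reappears on the right. Since partial sums are finite, it can be
       absorbed, which produces the factor 2. *)
    assert (S1 : Cmod (e O) * rsum a N <= B + rsum a N * (Cmod (e O) / 2)).
    { rewrite <- rsum_scal. eapply Rle_trans; [apply rsum_le; intros; apply T|].
      rewrite rsum_plus. apply Rplus_le_compat; [apply HB|]. now apply rsum_cauchy_le. }
    fold a. apply Rmult_le_reg_l with (Cmod (e O) / 2); [lra|].
    replace (Cmod (e O) / 2 * (2 / Cmod (e O) * B)) with B by (field; lra). lra.
Qed.

Lemma rsum_geom_le t N : 0 <= t <= / 2 -> rsum (fun j => t ^ j) N <= 2.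
Proof.
  intros Ht. assert (H : rsum (fun j => t ^ j) N <= 2 - 2 * t ^ N).
  { induction N; simpl; [lra|]. assert (0 <= t ^ N) by (apply pow_le; lra). nra. }
  assert (0 <= t ^ N) by (apply pow_le; lra). lra.
Qed.

(** The radius has to stay below [s] for the powers of [y] and below [/ rho] for the powers of
    [x]. *)
Lemma conv2_of_bound a s rho K : 0 < s -> 0 < rho ->
  (forall n j, Cmod (a n j) * s ^ j <= K * rho ^ n) -> conv2 a.
Proof.
  intros Hs Hr H. set (r := Rmin s (/ rho)).
  assert (Hi : 0 < / rho) by now apply Rinv_0_lt_compat.
  assert (r0 : 0 < r) by now apply Rmin_pos.
  exists r, K. split; [exact r0|]. intros n j.
  assert (Hp : 0 < rho ^ n) by now apply pow_lt.
  assert (E1 : r ^ j <= s ^ j) by (apply pow_incr; split; [lra|apply Rmin_l]).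
  assert (E2 : r ^ n <= / rho ^ n).
  { rewrite <- pow_inv. apply pow_incr; split; [lra|apply Rmin_r]. }
  pose proof (Cmod_ge_0 (a n j)). assert (0 < r ^ j) by now apply pow_lt.
  assert (0 < r ^ n) by now apply pow_lt. assert (0 < s ^ j) by now apply pow_lt.
  rewrite pow_add. apply Rle_trans with (Cmod (a n j) * (/ rho ^ n * s ^ j)).
  - apply Rmult_le_compat_l; [lra|]. apply Rmult_le_compat; lra.
  - apply Rmult_le_reg_r with (rho ^ n); [lra|].
    replace (Cmod (a n j) * (/ rho ^ n * s ^ j) * rho ^ n) with (Cmod (a n j) * s ^ j) by (field; lra).
    apply H.
Qed.

(** Solves the growth recursion of Weierstrass division: if row [n] is bounded by [sigma ^ n] plus
    [E] times the convolution of the earlier bounds with powers of [sigma], then the bound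
    [(sigma * (1 + E)) ^ n] reproduces itself exactly. *)
Lemma geometric_convolution E sigma n :
  E * rsum (fun i => (sigma * (1 + E)) ^ i * sigma ^ (n - i)) n = (sigma * (1 + E)) ^ n - sigma ^ n.
Proof.
  induction n; [simpl; ring|].
  change (rsum (fun i => (sigma * (1 + E)) ^ i * sigma ^ (S n - i)) (S n)) with
    (rsum (fun i => (sigma * (1 + E)) ^ i * sigma ^ (S n - i)) n + (sigma * (1 + E)) ^ n * sigma ^ (S n - n)).
  replace (S n - n)%nat with 1%nat by lia.
  rewrite (rsum_ext _ (fun i => sigma * ((sigma * (1 + E)) ^ i * sigma ^ (n - i)))).
  - rewrite rsum_scal. simpl. nra.
  - intros k Hk. replace (S n - k)%nat with (S (n - k)) by lia. simpl. ring.
Qed.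

Lemma conv2_rows a : conv2 a -> exists r K, 0 < r /\ 0 < K /\
  forall i j, Cmod (a i j) <= K * (/ r) ^ i * (/ r) ^ j.
Proof.
  intros (r & K & Hr & H). exists r, (Rabs K + 1). split; [exact Hr|].
  split; [pose proof (Rabs_pos K); lra|]. intros i j.
  specialize (H i j). rewrite pow_add in H. rewrite !pow_inv.
  assert (0 < r ^ i) by now apply pow_lt. assert (0 < r ^ j) by now apply pow_lt.
  apply Rmult_le_reg_r with (r ^ i * r ^ j); [now apply Rmult_lt_0_compat|].
  replace ((Rabs K + 1) * / r ^ i * / r ^ j * (r ^ i * r ^ j)) with (Rabs K + 1) by (field; lra).
  pose proof (Rle_abs K). lra.
Qed.

Definition mono (M n j : nat) : C := if andb (n =? 0)%nat (j =? M)%nat then RtoC 1 else RtoC 0.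

(* Weierstrass division of [y^M] by [P], solved row by row in the powers of [x]: row [n] of [Q] is
   found by dividing by the unit [P(0,y)/y^M]. *)
Lemma weierstrass_division (P : nat -> nat -> C) (M : nat) : conv2 P ->
  (forall j, (j < M)%nat -> P O j = RtoC 0) -> P O M <> RtoC 0 ->
  exists Q w, conv2 Q /\ conv2 w /\ Q O O <> RtoC 0 /\
    (forall n j, csum (fun i => cauchy_prod (Q i) (P (n - i)%nat) j) (S n) = w n j) /\
    (forall n j, (M <= j)%nat -> w n j = mono M n j) /\
    (forall j, (j < M)%nat -> w O j = RtoC 0).
Proof.
  intros HP P0 PM. destruct (conv2_rows _ HP) as (r & K & Hr & HK & B).
  assert (e0 : 0 < Cmod (P O M)) by now apply Cmod_gt_0.
  set (sg := / r) in *. assert (Hsg : 0 < sg) by now apply Rinv_0_lt_compat.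
  assert (HsM : 0 < sg ^ M) by now apply pow_lt.
  (* The bound [/ 2] keeps the geometric row sums below 2; the other one makes the tail of
     [P(0,y)/y^M] at most half of its constant term, as [unit_division] demands. *)
  set (t := Rmin (/ 2) (Cmod (P O M) / (4 * K * sg ^ M))).
  assert (Ht : 0 < t <= / 2).
  { split; [|apply Rmin_l]. apply Rmin_pos; [lra|]. apply Rdiv_lt_0_compat; [lra|].
    apply Rmult_lt_0_compat; [lra|exact HsM]. }
  assert (Ht2 : K * sg ^ M * t * 2 <= Cmod (P O M) / 2).
  { assert (t <= Cmod (P O M) / (4 * K * sg ^ M)) by apply Rmin_r.
    replace (Cmod (P O M) / 2) with (K * sg ^ M * (Cmod (P O M) / (4 * K * sg ^ M)) * 2) by (field; lra).
    apply Rmult_le_compat_r; [lra|]. apply Rmult_le_compat_l; [|exact H].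
    apply Rmult_le_pos; lra. }
  set (s := t * r). assert (Hs : 0 < s) by (apply Rmult_lt_0_compat; lra).
  assert (sgs : forall j, sg ^ j * s ^ j = t ^ j).
  { intros j. rewrite <- Rpow_mult_distr. f_equal. unfold sg, s. field. lra. }
  assert (NP : forall i, norm_le s (P i) (2 * K * sg ^ i)).
  { intros i N. eapply Rle_trans with (rsum (fun j => K * sg ^ i * t ^ j) N).
    - apply rsum_le. intros j _. rewrite <- sgs, <- Rmult_assoc.
      apply Rmult_le_compat_r; [apply pow_le; lra|apply B].
    - rewrite rsum_scal. assert (0 < sg ^ i) by now apply pow_lt.
      assert (0 < K * sg ^ i) by now apply Rmult_lt_0_compat.
      replace (2 * K * sg ^ i) with (K * sg ^ i * 2) by ring. apply Rmult_le_compat_l; [lra|]. apply rsum_geom_le. lra. }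
  set (e := fun j => P O (M + j)%nat).
  assert (eO : e O = P O M) by (unfold e; now rewrite Nat.add_0_r).
  assert (He0 : e O <> RtoC 0) by now rewrite eO.
  assert (Hes : forall N, rsum (fun j => Cmod (e (S j)) * s ^ S j) N <= Cmod (e O) / 2).
  { intros N. rewrite eO. eapply Rle_trans; [|exact Ht2].
    apply Rle_trans with (rsum (fun j => K * sg ^ M * t * t ^ j) N).
    - apply rsum_le. intros j _.
      replace (K * sg ^ M * t * t ^ j) with (K * sg ^ M * t ^ S j) by (simpl; ring).
      rewrite <- sgs. eapply Rle_trans; [apply Rmult_le_compat_r; [apply pow_le; lra|apply B]|].
      rewrite pow_add. apply Req_le. simpl. ring.
    - rewrite rsum_scal. apply Rmult_le_compat_l; [|apply rsum_geom_le; lra].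
      apply Rmult_le_pos; [apply Rmult_le_pos|]; lra. }
  pose proof (unit_division e s He0 Hs Hes) as div. rewrite eO in div.
  set (quo := fun g => proj1_sig (div g)).
  (* The target minus the contributions of the earlier rows. In degrees at least [M] this must be
     the product of row [n] of [Q] with [P O]; in lower degrees that product is 0, and [G] is the
     remainder up to sign. *)
  set (G := fun n (Q : nat -> nat -> C) j =>
    (mono M n j - csum (fun i => cauchy_prod (Q i) (P (n - i)%nat) j) n)%C).
  destruct (strong_recursion (fun _ => RtoC 0)
    (fun n Q => quo (fun j => G n Q (M + j)%nat))) as [Q HQ].
  { intros n f h E.
    enough (X : (fun j => G n f (M + j)%nat) = (fun j => G n h (M + j)%nat)) by now rewrite X.
    apply functional_extensionality. intros j. unfold G. f_equal. apply csum_ext. intros i Hi. now rewrite E. }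
  assert (Hdiv : forall n, (forall j, cauchy_prod (Q n) e j = G n Q (M + j)%nat) /\
    forall B, norm_le s (fun j => G n Q (M + j)%nat) B -> norm_le s (Q n) (2 / Cmod (P O M) * B)).
  { intros n. rewrite (HQ n). exact (proj2_sig (div (fun j => G n Q (M + j)%nat))). }
  assert (sM : 0 < s ^ M) by now apply pow_lt.
  set (D := 2 / Cmod (P O M)). assert (HD : 0 < D) by (apply Rdiv_lt_0_compat; lra).
  (* Shifting by [M] and dividing costs [D / s ^ M], a row of [P] costs [2 * K];
     [geometric_convolution] then dictates the rate [rho]. *)
  set (E := D / s ^ M * (2 * K)).
  assert (HE : 0 < E) by (apply Rmult_lt_0_compat; [now apply Rdiv_lt_0_compat|lra]).
  set (rho := sg * (1 + E)). assert (Hrho : 0 < rho) by (apply Rmult_lt_0_compat; lra).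
  assert (NG : forall n, (forall i, (i < n)%nat -> norm_le s (Q i) (D * rho ^ i)) ->
    norm_le s (G n Q) (s ^ M * rho ^ n)).
  { intros n IH. unfold G, Cminus.
    assert (M1 : norm_le s (fun j => mono M n j) (s ^ M * sg ^ n)).
    { intros N. apply Rle_trans with (rsum (fun j => if (j =? M)%nat then s ^ M * sg ^ n else 0) N).
      - apply rsum_le. intros j _. unfold mono. assert (0 < sg ^ n) by now apply pow_lt.
        destruct (Nat.eqb_spec n 0) as [->|]; destruct (Nat.eqb_spec j M) as [->|]; simpl;
          rewrite ?Cmod_1, ?Cmod_0; try lra.
        rewrite Rmult_0_l. apply Rmult_le_pos; lra.
      - assert (0 <= s ^ M * sg ^ n) by (apply Rmult_le_pos; apply pow_le; lra).
        assert (T : rsum (fun j => if (j =? M)%nat then s ^ M * sg ^ n else 0) N =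
          if (M <? N)%nat then s ^ M * sg ^ n else 0).
        { clear -N. induction N; [reflexivity|]. simpl rsum. rewrite IHN.
          destruct (Nat.eqb_spec N M); destruct (Nat.ltb_spec M N);
            destruct (Nat.ltb_spec M (S N)); try lia; lra. }
        rewrite T. destruct (M <? N)%nat; lra. }
    assert (M2 : norm_le s (fun j => csum (fun i => cauchy_prod (Q i) (P (n - i)%nat) j) n)
      (rsum (fun i => D * rho ^ i * (2 * K * sg ^ (n - i))) n)).
    { apply norm_le_csum; [exact Hs|]. intros i Hi.
      apply norm_le_cauchy_prod; auto.
      assert (0 < sg ^ (n - i)) by now apply pow_lt. apply Rmult_le_pos; lra. }
    replace (s ^ M * rho ^ n) with
      (s ^ M * sg ^ n + rsum (fun i => D * rho ^ i * (2 * K * sg ^ (n - i))) n).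
    - apply norm_le_plus; [exact Hs|exact M1|]. now apply norm_le_opp.
    - rewrite (rsum_ext _ (fun i => (s ^ M * E) * (rho ^ i * sg ^ (n - i)))).
      + rewrite rsum_scal, Rmult_assoc. unfold rho. rewrite geometric_convolution. ring.
      + intros i _. unfold E. field. lra. }
  assert (NQ : forall n, norm_le s (Q n) (D * rho ^ n)).
  { intros n. induction n as [n IH] using lt_wf_ind.
    replace (D * rho ^ n) with (D * (s ^ M * rho ^ n / s ^ M)) by (field; lra).
    apply Hdiv. apply (norm_le_shift s (G n Q) _ M Hs). apply NG. exact IH. }
  assert (QP : forall n j, (M <= j)%nat -> cauchy_prod (Q n) (P O) j = G n Q j).
  { intros n j Hj. replace j with (M + (j - M))%nat at 2 by lia.
    rewrite <- (proj1 (Hdiv n)). unfold cauchy_prod.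
    replace (S j) with (S (j - M) + M)%nat by lia. rewrite csum_split.
    rewrite (csum_0 _ M), Cplus_0_r.
    - apply csum_ext. intros k Hk. unfold e. do 2 f_equal. lia.
    - intros k Hk. rewrite P0 by lia. ring. }
  assert (QP0 : forall n j, (j < M)%nat -> cauchy_prod (Q n) (P O) j = RtoC 0).
  { intros n j Hj. apply csum_0. intros k Hk. rewrite P0 by lia. ring. }
  set (w := fun n j => csum (fun i => cauchy_prod (Q i) (P (n - i)%nat) j) (S n)).
  assert (wM : forall n j, (M <= j)%nat -> w n j = mono M n j).
  { intros n j Hj. unfold w. simpl csum. rewrite Nat.sub_diag, QP by exact Hj. unfold G. ring. }
  assert (wG : forall n j, (j < M)%nat -> w n j = (- G n Q j)%C).
  { intros n j Hj. unfold w. simpl csum. rewrite Nat.sub_diag, QP0 by exact Hj. unfold G, mono.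
    destruct (Nat.eqb_spec j M); [lia|]. rewrite Bool.andb_false_r. ring. }
  exists Q, w. repeat split.
  - apply (conv2_of_bound _ s rho D Hs Hrho). intros n j. now apply norm_le_term.
  - apply (conv2_of_bound _ s rho (s ^ M) Hs Hrho). intros n j.
    destruct (Nat.lt_ge_cases j M) as [Hj|Hj].
    + rewrite wG, Cmod_opp by exact Hj. apply norm_le_term; auto.
    + rewrite wM by exact Hj. unfold mono. assert (0 < rho ^ n) by now apply pow_lt.
      destruct (Nat.eqb_spec n 0) as [->|]; destruct (Nat.eqb_spec j M) as [->|]; simpl;
          rewrite ?Cmod_1, ?Cmod_0; try lra; rewrite Rmult_0_l; apply Rmult_le_pos; lra.
  (* With a zero constant term of [Q], row 0 of the product would have coefficient 0 at [y^M], where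
     it has 1. *)
  - intros Z. assert (X : w O M = RtoC 0).
    { unfold w. simpl. rewrite Cplus_0_l. apply csum_0. intros k Hk.
      destruct k; [rewrite Z; ring|]. rewrite P0 by lia. ring. }
    rewrite wM in X by lia. unfold mono in X. rewrite !Nat.eqb_refl in X. simpl in X.
    apply RtoC_inj in X. lra.
  - exact wM.
  - intros j Hj. rewrite wG by exact Hj. unfold G, mono. simpl.
    destruct (Nat.eqb_spec j M); [lia|]. ring.
Qed.

(** * Values of two-variable series *)

Definition near2 (P : C -> C -> Prop) : Prop :=
  exists d, 0 < d /\ forall x y, Cmod x < d -> Cmod y < d -> P x y.

Lemma near2_and P Q : near2 P -> near2 Q -> near2 (fun x y => P x y /\ Q x y).
Proof.
  intros (d & Hd & H) (e & He & H'). exists (Rmin d e). split; [now apply Rmin_pos|].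
  intros x y Hx Hy. pose proof (Rmin_l d e). pose proof (Rmin_r d e).
  split; [apply H|apply H']; lra.
Qed.

Lemma near2_mono (P Q : C -> C -> Prop) : (forall x y, P x y -> Q x y) -> near2 P -> near2 Q.
Proof. intros PQ (d & Hd & H). exists d. split; auto. Qed.

Lemma near_near2 P : near P -> near2 (fun x _ => P x).
Proof. intros (d & Hd & H). exists d. split; auto. Qed.

(** The order of summation is that of [eval2], but [x ^ i] is kept out of the inner series, so that
    one-variable results apply at both levels. *)
Definition row_sums (a : nat -> nat -> C) (x y v : C) : Prop :=
  exists A, (forall i, csums (fun j => a i j * y ^ j)%C (A i)) /\ csums (fun i => A i * x ^ i)%C v.

Lemma row_sums_eval2 a x y v : row_sums a x y v -> eval2 a x y = v.
Proof.
  intros (A & H1 & H2). unfold eval2. rewrite <- (csums_unique _ _ H2). f_equal.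
  apply functional_extensionality. intros i. apply csums_unique.
  rewrite Cmult_comm. eapply csums_ext; [|exact (csums_scal (x ^ i)%C _ _ (H1 i))].
  intros j. simpl. ring.
Qed.

(** At half the Cauchy radius all series are dominated by geometric ones of ratio 1/2. *)
Lemma conv2_row_sums a : conv2 a -> near2 (fun x y => row_sums a x y (eval2 a x y)).
Proof.
  intros H. destruct (conv2_rows _ H) as (r & K & Hr & HK & B).
  exists (r / 2). split; [lra|]. intros x y Hx Hy.
  assert (P : forall z n, Cmod z < r / 2 -> (/ r) ^ n * Cmod z ^ n <= (/ 2) ^ n).
  { intros z n Hz. rewrite <- Rpow_mult_distr. apply pow_incr. pose proof (Cmod_ge_0 z).
    assert (0 < / r) by now apply Rinv_0_lt_compat. split; [apply Rmult_le_pos; lra|].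
    apply Rmult_le_reg_l with r; [lra|]. rewrite <- Rmult_assoc, Rinv_r; lra. }
  assert (Q : forall n, 0 < (/ r) ^ n) by (intros; apply pow_lt, Rinv_0_lt_compat; lra).
  assert (S1 : forall i, csums (fun j => a i j * y ^ j)%C (CSeries (fun j => a i j * y ^ j)%C) /\
    Cmod (CSeries (fun j => a i j * y ^ j)%C) <= 2 * (K * (/ r) ^ i / (1 - / 2))).
  { intros i. apply csums_geom_bound; [lra|]. intros j. rewrite Cmod_mult, Cmod_pow.
    eapply Rle_trans; [apply Rmult_le_compat_r; [apply pow_le, Cmod_ge_0|apply B]|].
    rewrite Rmult_assoc. apply Rmult_le_compat_l; [|now apply P].
    apply Rmult_le_pos; [lra|]. left. apply Q. }
  assert (S2 : row_sums a x y (CSeries (fun i => CSeries (fun j => a i j * y ^ j)%C * x ^ i)%C)).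
  { exists (fun i => CSeries (fun j => a i j * y ^ j)%C). split; [apply S1|].
    apply (csums_geom_bound _ (4 * K) (/ 2)); [lra|]. intros i. rewrite Cmod_mult, Cmod_pow.
    eapply Rle_trans; [apply Rmult_le_compat_r; [apply pow_le, Cmod_ge_0|apply S1]|].
    replace (2 * (K * (/ r) ^ i / (1 - / 2)) * Cmod x ^ i) with (4 * K * ((/ r) ^ i * Cmod x ^ i)) by field.
    apply Rmult_le_compat_l; [lra|now apply P]. }
  rewrite (row_sums_eval2 _ _ _ _ S2). exact S2.
Qed.

(** Two one-variable Cauchy products suffice: in [y] for each pair of rows, then in [x] for the row
    sums. *)
Lemma eval2_mult a b c : conv2 a -> conv2 b ->
  (forall n j, csum (fun i => cauchy_prod (a i) (b (n - i)%nat) j) (S n) = c n j) ->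
  near2 (fun x y => eval2 c x y = eval2 a x y * eval2 b x y)%C.
Proof.
  intros Ha Hb Hc.
  refine (near2_mono _ _ _ (near2_and _ _ (conv2_row_sums _ Ha) (conv2_row_sums _ Hb))).
  intros x y [(A & A1 & A2) (B & B1 & B2)]. apply row_sums_eval2.
  exists (cauchy_prod A B). split.
  - intros n. eapply csums_ext with
      (f := fun j => csum (fun i => cauchy_prod (a i) (b (n - i)%nat) j * y ^ j)%C (S n)).
    + intros j. rewrite <- Hc, (Cmult_comm (csum _ _)), <- csum_scal.
      apply csum_ext. intros i _. ring.
    + apply (csums_csum (fun i j => cauchy_prod (a i) (b (n - i)%nat) j * y ^ j)%C). intros i _.
      eapply csums_ext; [|apply (csums_mult _ _ _ _ (A1 i) (B1 (n - i)%nat))].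
      intros j. apply cauchy_pow.
  - eapply csums_ext; [|apply (csums_mult _ _ _ _ A2 B2)]. intros n. apply cauchy_pow.
Qed.

(** Splits off the part free of [y]; iterated, it brings a series that is polynomial in [y] into
    Horner form. *)
Lemma eval2_cons a f : conv2 (fun i j => a i (S j)) -> has_series (fun i => a i O) f ->
  near2 (fun x y => eval2 a x y = f x + y * eval2 (fun i j => a i (S j)) x y)%C.
Proof.
  intros Ha Hf.
  refine (near2_mono _ _ _ (near2_and _ _ (conv2_row_sums _ Ha) (near_near2 _ Hf))).
  intros x y [(A & A1 & A2) F]. apply row_sums_eval2.
  exists (fun i => a i O + y * A i)%C. split.
  - intros i. eapply csums_cons'; [|eapply csums_ext; [|apply (csums_scal y _ _ (A1 i))]];
      intros; simpl; ring.
  - eapply csums_ext; [|apply (csums_plus _ _ _ _ F (csums_scal y _ _ A2))].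
    intros n. simpl. ring.
Qed.

Lemma conv2_cons a b r K : 0 < r -> (forall n, Cmod (b n) * r ^ n <= K) -> conv2 a ->
  conv2 (fun i j => match j with O => b i | S j' => a i j' end).
Proof.
  intros Hr Hb (r' & K' & Hr' & Ha). set (d := Rmin r r').
  assert (Hd : 0 < d) by now apply Rmin_pos.
  exists d, (Rmax K (K' * d)). split; [exact Hd|]. intros i [|j].
  - eapply Rle_trans; [|apply Rmax_l]. rewrite Nat.add_0_r. eapply Rle_trans; [|apply Hb].
    apply Rmult_le_compat_l; [apply Cmod_ge_0|]. apply pow_incr. split; [lra|apply Rmin_l].
  - eapply Rle_trans; [|apply Rmax_r]. rewrite Nat.add_succ_r. simpl.
    replace (Cmod (a i j) * (d * d ^ (i + j))) with (Cmod (a i j) * d ^ (i + j) * d) by ring.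
    apply Rmult_le_compat_r; [lra|]. eapply Rle_trans; [|apply Ha].
    apply Rmult_le_compat_l; [apply Cmod_ge_0|]. apply pow_incr. split; [lra|apply Rmin_r].
Qed.

Lemma conv2_uncons a : conv2 a -> analytic (fun x => CSeries (fun i => a i O * x ^ i)%C) /\
  has_series (fun i => a i O) (fun x => CSeries (fun i => a i O * x ^ i)%C) /\
  conv2 (fun i j => a i (S j)).
Proof.
  intros (r & K & Hr & H).
  assert (S1 : has_series (fun i => a i O) (fun x => CSeries (fun i => a i O * x ^ i)%C)).
  { exists r. split; [exact Hr|]. apply (has_series_of_bound _ r K Hr).
    intros n. specialize (H n O). now rewrite Nat.add_0_r in H. }
  split; [eexists; exact S1|]. split; [exact S1|].
  exists r, (K / r). split; [exact Hr|]. intros i j. specialize (H i (S j)).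
  rewrite Nat.add_succ_r in H. simpl in H. apply Rmult_le_reg_r with r; [lra|].
  replace (K / r * r) with K by (field; lra). lra.
Qed.

Lemma eval2_mono0 x y : eval2 (mono 0) x y = RtoC 1.
Proof.
  apply row_sums_eval2. exists (fun i => match i with O => RtoC 1 | _ => RtoC 0 end). split.
  - intros [|i].
    + eapply csums_cons'; [|eapply csums_ext; [|apply csums_0]]; intros; unfold mono; simpl; ring.
    + eapply csums_ext; [|apply csums_0]. intros; unfold mono; simpl; ring.
  - eapply csums_cons'; [|eapply csums_ext; [|apply csums_0]]; intros; simpl; ring.
Qed.

Lemma conv2_mono0 : conv2 (mono 0).
Proof.
  exists 1, 1. split; [lra|]. intros i j. rewrite pow1, Rmult_1_r. unfold mono.
  destruct (_ && _)%bool; rewrite ?Cmod_1, ?Cmod_0; lra.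
Qed.

(** * Monic polynomials *)

(* The list [[c_0; ...; c_(n-1)]] stands for [c_0 + c_1 y + ... + c_(n-1) y^(n-1) + y^n]. *)
Fixpoint mev (l : list C) (y : C) : C :=
  match l with nil => RtoC 1 | c :: l' => (c + y * mev l' y)%C end.

Definition values (F : list (C -> C)) (x : C) : list C := map (fun f => f x) F.

(** From column [M] on the series looks like [y^M], so removing the column of [y^0] repeatedly ends
    at the constant 1. *)
Lemma polynomial_of_rows M : forall w, conv2 w -> (forall n j, (M <= j)%nat -> w n j = mono M n j) ->
  exists F, length F = M /\ Forall analytic F /\
    (forall j, (j < M)%nat -> nth j (values F (RtoC 0)) (RtoC 0) = w O j) /\
    near2 (fun x y => eval2 w x y = mev (values F x) y).
Proof.
  induction M; intros w Hw HM.
  - exists nil. repeat split; [constructor|intros; lia|].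
    exists 1. split; [lra|]. intros x y _ _. simpl. rewrite <- (eval2_mono0 x y). f_equal.
    do 2 (apply functional_extensionality; intros). apply HM. lia.
  - destruct (conv2_uncons _ Hw) as (Hf & Hs & Ht).
    destruct (IHM _ Ht) as (F & HL & HF & H0 & E).
    { intros n j Hj. rewrite HM by lia. unfold mono. reflexivity. }
    exists ((fun x => CSeries (fun i => w i O * x ^ i)%C) :: F). repeat split.
    + simpl. now rewrite HL.
    + now constructor.
    + intros [|j] Hj.
      * unfold values. cbn [map nth]. apply (has_series_0 _ _ Hs).
      * apply H0. lia.
    + refine (near2_mono _ _ _ (near2_and _ _ (eval2_cons _ _ Ht Hs) E)).
      intros x y [-> ->]. reflexivity.
Qed.

(** The way back from polynomials to series, so that preparation can be applied again at another
    point. The appended [RtoC 1] is the leading coefficient. *)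
Lemma rows_of_polynomial F : Forall analytic F ->
  exists a, conv2 a /\ (forall j, a O j = nth j (values F (RtoC 0) ++ RtoC 1 :: nil) (RtoC 0)) /\
    near2 (fun x y => eval2 a x y = mev (values F x) y).
Proof.
  induction 1 as [|f F [b Hb] HF (a & Ha & H0 & E)].
  - exists (mono 0). split; [apply conv2_mono0|]. split.
    + intros [|[|j]]; reflexivity.
    + exists 1. split; [lra|]. intros. apply eval2_mono0.
  - exists (fun i j => match j with O => b i | S j' => a i j' end). repeat split.
    + destruct (has_series_bound _ _ Hb) as (r & K & Hr & _ & B). now apply (conv2_cons a b r K).
    + intros [|j]; simpl; [|apply H0]. symmetry. now apply has_series_0.
    + refine (near2_mono _ _ _ (near2_and _ _
        (eval2_cons (fun i j => match j with O => b i | S j' => a i j' end) f Ha Hb) E)).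
      intros x y [-> E']. cbn [values map mev]. unfold values in E'. now rewrite <- E'.
Qed.

Lemma weierstrass_preparation a M : conv2 a ->
  (forall j, (j < M)%nat -> a O j = RtoC 0) -> a O M <> RtoC 0 ->
  exists u F, conv2 u /\ u O O <> RtoC 0 /\ length F = M /\ Forall analytic F /\
    Forall (fun f => f (RtoC 0) = RtoC 0) F /\
    near2 (fun x y => eval2 a x y = eval2 u x y * mev (values F x) y)%C.
Proof.
  intros Ha H0 HM.
  destruct (weierstrass_division a M Ha H0 HM) as (Q & w & HQ & Hw & Q0 & QP & wM & w0).
  (* Dividing [y^0 = 1] by [Q] leaves no room for a remainder: the quotient [u] is the inverse of
     [Q] and turns [Q a = w] into [a = u w]. *)
  destruct (weierstrass_division Q 0 HQ ltac:(lia) Q0) as (u & v & Hu & _ & u0 & uQ & v1 & _).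
  destruct (polynomial_of_rows M w Hw wM) as (F & HL & HF & F0 & E).
  exists u, F. repeat split; auto.
  - apply Forall_forall. intros f Hf. destruct (In_nth _ _ (fun _ => RtoC 0) Hf) as (j & Hj & <-).
    rewrite HL in Hj. specialize (F0 j Hj). rewrite w0 in F0 by exact Hj.
    etransitivity; [symmetry|exact F0]. exact (map_nth (fun f => f (RtoC 0)) F (fun _ => RtoC 0) j).
  - refine (near2_mono _ _ _ (near2_and _ _ E
      (near2_and _ _ (eval2_mult _ _ _ HQ Ha QP) (eval2_mult _ _ _ Hu HQ uQ)))).
    intros x y (<- & -> & E1).
    replace v with (mono 0) in E1.
    + rewrite eval2_mono0 in E1.
      replace (eval2 u x y * (eval2 Q x y * eval2 a x y))%C
        with (eval2 u x y * eval2 Q x y * eval2 a x y)%C by ring.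
      rewrite <- E1. ring.
    + do 2 (apply functional_extensionality; intros). symmetry. apply v1. lia.
Qed.

(* Transfers the algebraic closedness of MathComp's [R[i]] to Coquelicot's [C]. *)
Module FundamentalTheorem.
Import ssreflect ssrbool seq fintype bigop ssralg ssrnum complex Rstruct.
Import GRing.Theory.

Definition of_mc (z : complex R) : C := (complex.Re z, complex.Im z).
Definition to_mc (z : C) : complex R := Complex (fst z) (snd z).

Lemma of_mcD (z w : complex R) : of_mc (z + w)%R = Cplus (of_mc z) (of_mc w).
Proof. by case: z w => [a b] [c d]. Qed.

Lemma of_mcM (z w : complex R) : of_mc (z * w)%R = Cmult (of_mc z) (of_mc w).
Proof. by case: z w => [a b] [c d]. Qed.

Lemma mev_of_mc (l : list C) (z : complex R) :
  of_mc (\sum_(i < size l) nth 0%R (map to_mc l) i * z ^+ i + z ^+ size l)%R = mev l (of_mc z).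
Proof.
elim: l => [|c l IH].
  by rewrite big_ord0 add0r expr0.
rewrite big_ord_recl /= -IH expr0 mulr1.
have -> : (\sum_(i < size l) nth 0 (map to_mc l) i * z ^+ bump 0 i =
  z * \sum_(i < size l) nth 0 (map to_mc l) i * z ^+ i)%R.
  rewrite big_distrr /=; apply: eq_bigr => i _.
  by rewrite /bump /= exprS mulrCA.
rewrite -addrA exprS -mulrDr.
by rewrite of_mcD of_mcM; case: c.
Qed.

Lemma mev_root (l : list C) : l <> nil -> exists z, mev l z = RtoC 0.
Proof.
move=> l0.
(* The closed-field axiom solves an equation of the form [z^n = sum P_i z^i], hence the minus
   sign. *)
have [|z Hz] := @complex_acf_axiom (R : rcfType) (size l) (fun i => - nth 0 (map to_mc l) i)%R.
  by case: l l0.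
exists (of_mc z); rewrite -mev_of_mc Hz -big_split /=.
by rewrite big1 // => i _; rewrite mulNr addrN.
Qed.

End FundamentalTheorem.

(** Synthetic division of [c :: l] by [y - z]: the Horner values at [z] are the coefficients of the
    quotient. The constant term [c] affects only the remainder, so the argument is the tail [l]. *)
Fixpoint quot (z : C) (l : list C) : list C :=
  match l with nil => nil | _ :: l' => mev l z :: quot z l' end.

Lemma length_quot z l : length (quot z l) = length l.
Proof. induction l; simpl; auto. Qed.

Lemma mev_quot c l y z : (mev (c :: l) y - mev (c :: l) z = (y - z) * mev (quot z l) y)%C.
Proof.
  revert c. induction l as [|d l IH]; intros c; [simpl; ring|].
  cbn [quot]. change (mev (mev (d :: l) z :: quot z l) y) with (mev (d :: l) z + y * mev (quot z l) y)%C.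
  specialize (IH d).
  change (mev (c :: d :: l) y) with (c + y * mev (d :: l) y)%C.
  change (mev (c :: d :: l) z) with (c + z * mev (d :: l) z)%C.
  replace ((y - z) * (mev (d :: l) z + y * mev (quot z l) y))%C
    with ((y - z) * mev (d :: l) z + y * ((y - z) * mev (quot z l) y))%C by ring.
  rewrite <- IH. ring.
Qed.

(* [addmul p z l] is the polynomial [p + (y + z) l(y)]. *)
Fixpoint addmul (p z : C) (l : list C) : list C :=
  match l with nil => (p + z)%C :: nil | e :: l' => (p + z * e)%C :: addmul e z l' end.

Lemma length_addmul p z l : length (addmul p z l) = S (length l).
Proof. revert p. induction l; intros; simpl; auto. Qed.

Lemma mev_addmul p z l y : (mev (addmul p z l) y = p + (z + y) * mev l y)%C.
Proof.
  revert p. induction l as [|e l IH]; intros; simpl; [ring|]. rewrite IH. ring.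
Qed.

(** Division with remainder as an equality of coefficient lists and not only of values, so that
    Vieta's formulas can be read off after splitting. *)
Lemma addmul_quot c l z : addmul (mev (c :: l) z) (- z)%C (quot z l) = c :: l.
Proof.
  revert c. induction l as [|d l IH]; intros c.
  - simpl. f_equal. ring.
  - cbn [quot addmul]. rewrite IH. f_equal. simpl. ring.
Qed.

Fixpoint mshift (z : C) (l : list C) : list C :=
  match l with nil => nil | c :: l' => addmul c z (mshift z l') end.

Lemma length_mshift z l : length (mshift z l) = length l.
Proof. induction l; simpl; [reflexivity|]. now rewrite length_addmul, IHl. Qed.

Lemma mev_mshift z l y : mev (mshift z l) y = mev l (z + y)%C.
Proof. induction l as [|c l IH]; simpl; [reflexivity|]. now rewrite mev_addmul, IH. Qed.

(** * Polynomials given by their roots *)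

Definition prodl (L : list C) (y : C) : C := fold_right (fun z p => (y - z) * p)%C (RtoC 1) L.

Fixpoint of_roots (L : list C) : list C :=
  match L with nil => nil | z :: L' => addmul (RtoC 0) (- z)%C (of_roots L') end.

Lemma length_of_roots L : length (of_roots L) = length L.
Proof. induction L; simpl; [reflexivity|]. now rewrite length_addmul, IHL. Qed.

Lemma mev_of_roots L y : mev (of_roots L) y = prodl L y.
Proof.
  induction L as [|z L IH]; simpl; [reflexivity|]. rewrite mev_addmul, IH. ring.
Qed.

Lemma split_of_roots l : exists L, l = of_roots L.
Proof.
  remember (length l) as n eqn:Hn. revert l Hn. induction n; intros l Hn.
  - exists nil. destruct l; [reflexivity|discriminate].
  - destruct l as [|c l]; [discriminate|].
    destruct (FundamentalTheorem.mev_root (c :: l)) as [z Hz]; [discriminate|].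
    destruct (IHn (quot z l)) as [L HL]. { rewrite length_quot. now injection Hn. }
    exists (z :: L). simpl. rewrite <- HL, <- Hz. symmetry. apply addmul_quot.
Qed.

Lemma prodl_root L z : In z L -> prodl L z = RtoC 0.
Proof.
  induction L as [|w L IH]; simpl; [tauto|]. intros [->|H]; [ring|].
  fold (prodl L z). rewrite IH by exact H. ring.
Qed.

(* [coef t l] is the coefficient of [y^(n-1-t)], where [n] is the degree. *)
Fixpoint coef (t : nat) (l : list C) : C :=
  match l with nil => RtoC 0 | c :: l' => if (length l' =? t)%nat then c else coef t l' end.

(** The implicit leading coefficient 1 of [l] contributes the summand [z]; [p] reaches this
    coefficient only when [l] has degree 0. *)
Lemma coef0_addmul p z l : coef 0 (addmul p z l) = (z + match l with nil => p | _ => coef 0 l end)%C.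
Proof.
  revert p. induction l as [|e l IH]; intros p; [simpl; ring|].
  cbn [addmul coef]. rewrite length_addmul. cbn [Nat.eqb]. rewrite IH.
  destruct l; reflexivity.
Qed.

Lemma coef1_addmul p z l : coef 1 (addmul p z l) =
  (match l with nil => RtoC 0 | _ :: nil => p | _ => coef 1 l end + z * coef 0 l)%C.
Proof.
  revert p. induction l as [|e l IH]; intros p; [simpl; ring|].
  cbn [addmul coef]. rewrite length_addmul. destruct l as [|d l]; [reflexivity|].
  cbn [length Nat.eqb]. rewrite IH. destruct l as [|b l]; reflexivity.
Qed.

(** The translation moves every root by [- z], hence minus their sum by the degree times [z]; a
    suitable [z] centres the roots. *)
Lemma coef0_mshift z l : coef 0 (mshift z l) = (RtoC (INR (length l)) * z + coef 0 l)%C.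
Proof.
  induction l as [|c l IH]; [simpl; ring|].
  cbn [mshift]. rewrite coef0_addmul. change (length (c :: l)) with (S (length l)).
  rewrite S_INR, RtoC_plus. destruct l as [|d l]; [simpl; ring|].
  destruct (mshift z (d :: l)) eqn:E.
  - pose proof (length_mshift z (d :: l)) as X. rewrite E in X. discriminate.
  - rewrite IH. change (coef 0 (c :: d :: l)) with (coef 0 (d :: l)). ring.
Qed.

Definition lsum (L : list C) : C := fold_right Cplus (RtoC 0) L.
Definition lsumsq (L : list C) : C := fold_right (fun z s => z * z + s)%C (RtoC 0) L.

Lemma coef0_of_roots L : coef 0 (of_roots L) = (- lsum L)%C.
Proof.
  induction L as [|z L IH]; [simpl; ring|]. cbn [of_roots lsum fold_right]. fold (lsum L).
  rewrite coef0_addmul. destruct (of_roots L) eqn:E.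
  - simpl in IH. rewrite IH. ring.
  - rewrite IH. ring.
Qed.

(** Newton's identity p2 = e1^2 - 2 e2; the sign of [coef 0] disappears in the square. *)
Lemma lsumsq_of_roots L :
  lsumsq L = (coef 0 (of_roots L) * coef 0 (of_roots L) - RtoC 2 * coef 1 (of_roots L))%C.
Proof.
  induction L as [|z L IH]; [simpl; ring|]. cbn [of_roots lsumsq fold_right]. fold (lsumsq L).
  rewrite coef0_addmul, coef1_addmul, IH.
  destruct (of_roots L) as [|d [|e l]]; cbn [coef length Nat.eqb]; ring.
Qed.

(** The coefficient of [y^(n-k)] is measured against [B ^ k], its natural size when all roots are at
    most [B]. *)
Fixpoint weighted (K B : R) (l : list C) : Prop :=
  match l with nil => True | c :: l' => Cmod c <= K * B ^ S (length l') /\ weighted K B l' end.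

Lemma weighted_addmul K B p z l : 1 <= K -> 0 <= B -> Cmod z <= B ->
  Cmod p <= K * B ^ S (length l) -> weighted K B l -> weighted (2 * K) B (addmul p z l).
Proof.
  intros HK HB Hz. revert p. induction l as [|e l IH]; intros p Hp Hl.
  - simpl in *. split; [|exact I]. eapply Rle_trans; [apply Cmod_triangle|]. nra.
  - destruct Hl as [He Hl]. cbn [addmul weighted]. split; [|now apply IH].
    rewrite length_addmul. eapply Rle_trans; [apply Cmod_triangle|]. rewrite Cmod_mult.
    assert (Cmod z * Cmod e <= B * (K * B ^ S (length l))).
    { apply Rmult_le_compat; auto; apply Cmod_ge_0. }
    simpl in *. lra.
Qed.

Lemma weighted_of_roots B L : 0 <= B -> (forall z, In z L -> Cmod z <= B) ->
  weighted (2 ^ length L) B (of_roots L).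
Proof.
  intros HB. induction L as [|z L IH]; intros H; [exact I|].
  cbn [of_roots length]. apply weighted_addmul.
  - apply pow_R1_Rle. lra.
  - exact HB.
  - rewrite Cmod_opp. apply H. now left.
  - rewrite Cmod_0. apply Rmult_le_pos; apply pow_le; lra.
  - apply IH. intros w Hw. apply H. now right.
Qed.

(* The polynomial [l(y/s)], multiplied by [s^n]. *)
Fixpoint scale (s : C) (l : list C) : list C :=
  match l with nil => nil | c :: l' => (s ^ S (length l') * c)%C :: scale s l' end.

Lemma length_scale s l : length (scale s l) = length l.
Proof. induction l; simpl; auto. Qed.

Lemma mev_scale s l y : (mev (scale s l) (s * y) = s ^ length l * mev l y)%C.
Proof.
  induction l as [|c l IH]; [simpl; ring|]. cbn [scale mev length]. rewrite IH. simpl. ring.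
Qed.

Lemma coef_scale t s l : coef t (scale s l) = (s ^ S t * coef t l)%C.
Proof.
  induction l as [|c l IH]; [cbn [scale coef]; ring|]. cbn [scale coef]. rewrite length_scale.
  destruct (Nat.eqb_spec (length l) t) as [->|]; [reflexivity|exact IH].
Qed.

(** Every factor [z - w] with [w] real has the imaginary part of [z]. *)
Lemma Cmod_prodl_ge L z : (forall w, In w L -> Im w = 0) -> Rabs (Im z) ^ length L <= Cmod (prodl L z).
Proof.
  induction L as [|w L IH]; intros H; simpl; [rewrite Cmod_1; lra|].
  fold (prodl L z). rewrite Cmod_mult. apply Rmult_le_compat.
  - apply Rabs_pos.
  - apply pow_le, Rabs_pos.
  - eapply Rle_trans; [|apply im_le_Cmod]. apply Req_le. f_equal.
    specialize (H w (or_introl eq_refl)). unfold Im in *. simpl. rewrite H. ring.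
  - apply IH. intros v Hv. apply H. now right.
Qed.

(** A sum of squares of real numbers dominates each of them; here reality of the roots becomes a
    bound on their size. *)
Lemma lsumsq_real L : (forall z, In z L -> Im z = 0) ->
  exists s, lsumsq L = RtoC s /\ 0 <= s /\ forall z, In z L -> Cmod z ^ 2 <= s.
Proof.
  induction L as [|z L IH]; intros H.
  - exists 0. simpl. repeat split; [lra|tauto].
  - destruct IH as (s & E & Hs & B); [intros w Hw; apply H; now right|].
    assert (Hz : z = RtoC (Re z)).
    { apply C_ext; [reflexivity|]. rewrite im_RtoC. apply H. now left. }
    exists (Re z * Re z + s). simpl. fold (lsumsq L). rewrite E. repeat split.
    + rewrite Hz at 1 2. now rewrite <- RtoC_mult, <- RtoC_plus.
    + pose proof (Rle_0_sqr (Re z)). unfold Rsqr in *. lra.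
    + pose proof (Rle_0_sqr (Re z)) as Sq. unfold Rsqr in Sq. intros w [<-|Hw].
      * rewrite Hz at 1 2. rewrite Cmod_R. pose proof (Rsqr_abs (Re z)) as X. unfold Rsqr in X. lra.
      * specialize (B w Hw). simpl in B. lra.
Qed.

Lemma lsum_all_eq L z : (forall w, In w L -> w = z) -> lsum L = (RtoC (INR (length L)) * z)%C.
Proof.
  induction L as [|w L IH]; intros H; [simpl; ring|].
  cbn [lsum fold_right]. fold (lsum L). change (length (w :: L)) with (S (length L)).
  rewrite IH, S_INR, RtoC_plus, (H w).
  - ring.
  - now left.
  - intros v Hv. apply H. now right.
Qed.

Lemma lsumsq_all_0 L : (forall w, In w L -> w = RtoC 0) -> lsumsq L = RtoC 0.
Proof.
  induction L as [|w L IH]; intros H; [reflexivity|]. simpl. fold (lsumsq L).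
  rewrite IH, (H w); [ring|now left|]. intros v Hv. apply H. now right.
Qed.

Lemma mev_all_0 l y : (forall j, (j < length l)%nat -> nth j l (RtoC 0) = RtoC 0) ->
  (mev l y = y ^ length l)%C.
Proof.
  induction l as [|c l IH]; intros H; [reflexivity|]. simpl.
  pose proof (H O) as H0. simpl in H0. rewrite H0 by lia. rewrite IH; [ring|].
  intros j Hj. apply (H (S j)). simpl. lia.
Qed.

(** Coefficients this small exclude roots of modulus at least [e]. A Horner step yields at least 2
    (e/2)^(k+1) - (e/2)^(k+1), and [e <= 1] lets the single bound [(e / 2) ^ n] serve every
    coefficient. *)
Lemma Cmod_mev_ge e n l y : 0 < e <= 1 -> e <= Cmod y -> (length l <= n)%nat ->
  (forall c, In c l -> Cmod c <= (e / 2) ^ n) -> (e / 2) ^ length l <= Cmod (mev l y).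
Proof.
  intros He Hy. induction l as [|c l IH]; intros Hn Hc; simpl.
  - rewrite Cmod_1. lra.
  - simpl in Hn. assert (IHl : (e / 2) ^ length l <= Cmod (mev l y)).
    { apply IH; [lia|]. intros d Hd. apply Hc. now right. }
    assert (T : Cmod (y * mev l y) <= Cmod (c + y * mev l y) + Cmod c).
    { replace (y * mev l y)%C with ((c + y * mev l y) + - c)%C at 1 by ring.
      rewrite <- (Cmod_opp c). apply Cmod_triangle. }
    assert (Hcn : Cmod c <= (e / 2) ^ S (length l)).
    { eapply Rle_trans; [apply Hc; now left|].
      replace n with (S (length l) + (n - S (length l)))%nat by lia. rewrite pow_add.
      rewrite <- (Rmult_1_r ((e / 2) ^ S (length l))) at 2.
      apply Rmult_le_compat_l; [apply pow_le; lra|].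
      rewrite <- (pow1 (n - S (length l))). apply pow_incr. lra. }
    assert (e * (e / 2) ^ length l <= Cmod (y * mev l y)).
    { rewrite Cmod_mult. apply Rmult_le_compat; try lra. apply pow_le. lra. }
    simpl in Hcn. lra.
Qed.

(** * Families of monic polynomials with analytic coefficients *)

Lemma length_values F x : length (values F x) = length F.
Proof. apply length_map. Qed.

Lemma analytic_mev F phi : Forall analytic F -> analytic phi ->
  analytic (fun x => mev (values F x) (phi x)).
Proof.
  intros HF Hp. induction HF; simpl; [apply analytic_const|].
  apply analytic_plus; [assumption|]. now apply analytic_mult.
Qed.

Lemma analytic_coef t F : Forall analytic F -> analytic (fun x => coef t (values F x)).
Proof.
  intros HF. induction HF as [|f F Hf HF IH]; [exact (analytic_const (RtoC 0))|].
  replace (fun x => coef t (values (f :: F) x)) with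
    (if (length F =? t)%nat then f else fun x => coef t (values F x)).
  - now destruct (length F =? t)%nat.
  - apply functional_extensionality. intros x. cbn [values map coef].
    rewrite length_map. now destruct (length F =? t)%nat.
Qed.

(** The list operations are polynomial in their entries, so applied pointwise to a family they give
    analytic coefficients again; the same holds in the next two lemmas. *)
Lemma values_quot phi F : Forall analytic F -> analytic phi ->
  exists G, Forall analytic G /\ length G = length F /\ forall x, values G x = quot (phi x) (values F x).
Proof.
  intros HF Hp. induction HF as [|f F Hf HF (G & HG & HL & E)]; [now exists nil|].
  exists ((fun x => mev (values (f :: F) x) (phi x)) :: G). split; [|split].
  - constructor; [|exact HG]. apply analytic_mev; [now constructor|exact Hp].
  - simpl. now rewrite HL.
  - intros x. simpl. now rewrite E.
Qed.

Lemma values_addmul psi F : Forall analytic F -> analytic psi -> forall p, analytic p ->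
  exists G, Forall analytic G /\ length G = S (length F) /\
    forall x, values G x = addmul (p x) (psi x) (values F x).
Proof.
  intros HF Hp. induction HF as [|f F Hf HF IH]; intros p Hpp.
  - exists ((fun x => p x + psi x)%C :: nil). repeat split. constructor; [|constructor].
    now apply analytic_plus.
  - destruct (IH f Hf) as (G & HG & HL & E).
    exists ((fun x => p x + psi x * f x)%C :: G). split; [|split].
    + constructor; [|exact HG]. apply analytic_plus; [exact Hpp|]. now apply analytic_mult.
    + simpl. now rewrite HL.
    + intros x. simpl. now rewrite E.
Qed.

Lemma values_mshift psi F : Forall analytic F -> analytic psi ->
  exists G, Forall analytic G /\ length G = length F /\
    forall x, values G x = mshift (psi x) (values F x).
Proof.
  intros HF Hp. induction HF as [|f F Hf HF (G & HG & HL & E)]; [now exists nil|].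
  destruct (values_addmul psi G HG Hp f Hf) as (H & HH & HL' & E').
  exists H. split; [exact HH|]. split; [now rewrite HL', HL|].
  intros x. rewrite E', E. reflexivity.
Qed.

Lemma RtoC_neq_0 t : t <> 0 -> RtoC t <> RtoC 0.
Proof. intros H E. now apply RtoC_inj in E. Qed.

(** Growth along the positive axis alone determines the order: were it [k < n], then |f(t)| would
    behave like |g(0)| t^k, too large for small [t]. *)
Lemma analytic_divide f n K : analytic f -> near_pos (fun t => Cmod (f (RtoC t)) <= K * t ^ n) ->
  exists g, analytic g /\ near (fun x => f x = x ^ n * g x)%C.
Proof.
  intros Hf HB. destruct (analytic_order _ Hf) as [Z|(k & g & Hg & N & E)].
  { exists (fun _ => RtoC 0). split; [apply analytic_const|].
    refine (near_mono _ _ _ Z). intros x ->. ring. }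
  destruct (Nat.le_gt_cases n k) as [Hk|Hk].
  { exists (fun x => x ^ (k - n) * g x)%C. split; [apply analytic_mult; [apply analytic_pow|exact Hg]|].
    refine (near_mono _ _ _ E). intros x ->.
    replace k with (n + (k - n))%nat at 1 by lia. rewrite Cpow_add_r. ring. }
  exfalso. assert (P : 0 < Cmod (g (RtoC 0))) by now apply Cmod_gt_0.
  assert (P2 : 0 < Cmod (g (RtoC 0)) / 2) by lra.
  pose proof (Rabs_pos K) as HK.
  (* Below this bound (|K| + 1) t < |g(0)| / 2, while continuity keeps |g(t)| above |g(0)| / 2; the
     1 makes [t ^ (n - S k)] at most 1. *)
  assert (D : 0 < Rmin 1 (Cmod (g (RtoC 0)) / (2 * (Rabs K + 1)))).
  { apply Rmin_pos; [lra|]. apply Rdiv_lt_0_compat; lra. }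
  destruct (near_pos_inhab _ (near_pos_and _ _ HB (near_near_pos _ (near_and _ _ E
    (near_and _ _ (analytic_continuous _ Hg _ P2) (near_ball _ D))))))
    as (t & Ht & B & E' & C' & D').
  rewrite Cmod_R, Rabs_pos_eq in D' by lra.
  pose proof (Rmin_l 1 (Cmod (g (RtoC 0)) / (2 * (Rabs K + 1)))) as m1.
  pose proof (Rmin_r 1 (Cmod (g (RtoC 0)) / (2 * (Rabs K + 1)))) as m2.
  assert (tk : 0 < t ^ k) by now apply pow_lt.
  rewrite E', Cmod_mult, Cmod_pow, Cmod_R, (Rabs_pos_eq t) in B by lra.
  assert (B1 : Cmod (g (RtoC t)) <= (Rabs K + 1) * t).
  { apply Rmult_le_reg_l with (t ^ k); [exact tk|]. eapply Rle_trans; [exact B|].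
    replace n with (S (n - S k) + k)%nat by lia. rewrite pow_add. simpl.
    assert (Q : 0 <= t ^ (n - S k) <= 1).
    { split; [apply pow_le; lra|]. rewrite <- (pow1 (n - S k)). apply pow_incr. lra. }
    replace (K * (t * t ^ (n - S k) * t ^ k)) with (t ^ k * (t * (K * t ^ (n - S k)))) by ring.
    apply Rmult_le_compat_l; [lra|]. rewrite (Rmult_comm (Rabs K + 1)).
    apply Rmult_le_compat_l; [lra|]. pose proof (Rle_abs K). nra. }
  assert (B2 : (Rabs K + 1) * t < Cmod (g (RtoC 0)) / 2).
  { apply Rlt_le_trans with ((Rabs K + 1) * (Cmod (g (RtoC 0)) / (2 * (Rabs K + 1)))).
    - apply Rmult_lt_compat_l; lra.
    - apply Req_le. field. lra. }
  assert (B3 : Cmod (g (RtoC 0)) <= Cmod (g (RtoC t)) + Cmod (g (RtoC t) - g (RtoC 0))%C).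
  { rewrite <- (Cmod_opp (g (RtoC t) - g (RtoC 0))%C).
    replace (g (RtoC 0)) with (g (RtoC t) + - (g (RtoC t) - g (RtoC 0)))%C at 1 by ring.
    apply Cmod_triangle. }
  lra.
Qed.

(** For odd [n], dividing by [t ^ n] leaves a real [g] that is nonpositive on one side of 0 and
    nonnegative on the other, so continuity would force g(0) = 0. *)
Lemma even_order g n d : analytic g -> g (RtoC 0) <> RtoC 0 -> 0 < d ->
  (forall t, 0 < Rabs t < d -> exists s, (RtoC t ^ n * g (RtoC t) = RtoC s)%C /\ s <= 0) ->
  exists m, n = (m + m)%nat.
Proof.
  intros Hg N Hd H. destruct (Nat.Even_or_Odd n) as [[m ->]|[m ->]]; [exists m; lia|exfalso].
  assert (P : 0 < Cmod (g (RtoC 0))) by now apply Cmod_gt_0.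
  (* The real values at [e / 2] and [- (e / 2)], each this close to g(0), bound both |Re g(0)| and
     |Im g(0)| by |g(0)| / 4, which is too small for their sum. *)
  assert (P4 : 0 < Cmod (g (RtoC 0)) / 4) by lra.
  destruct (near_and _ _ (near_ball d Hd) (analytic_continuous _ Hg _ P4)) as (e & He & X).
  assert (V : forall t, t <> 0 -> Rabs t < e -> exists s, g (RtoC t) = RtoC (s / t) /\ s <= 0 /\
    Cmod (g (RtoC t) - g (RtoC 0))%C < Cmod (g (RtoC 0)) / 4).
  { intros t t0 Ht. destruct (X (RtoC t)) as [X1 X2]; [now rewrite Cmod_R|].
    rewrite Cmod_R in X1. destruct (H t) as (s & E & Hs).
    { split; [now apply Rabs_pos_lt|exact X1]. }
    assert (tm : 0 < (t * t) ^ m) by (apply pow_lt; nra).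
    exists (s / (t * t) ^ m). split; [|split; [|exact X2]].
    - assert (E2 : (RtoC t ^ (2 * m + 1) = RtoC ((t * t) ^ m) * RtoC t)%C).
      { rewrite Cpow_add_r, Cpow_mult_r, RtoC_pow, RtoC_mult. simpl. f_equal; [f_equal|]; ring. }
      rewrite E2 in E. assert (RtoC ((t * t) ^ m) <> RtoC 0) by (apply RtoC_neq_0; lra).
      assert (RtoC t <> RtoC 0) by now apply RtoC_neq_0.
      rewrite !RtoC_div, <- E by (try lra; exact t0). field. auto.
    - apply Rmult_le_reg_r with ((t * t) ^ m); [exact tm|].
      replace (s / (t * t) ^ m * (t * t) ^ m) with s by (field; lra). lra. }
  destruct (V (e / 2)) as (s1 & E1 & S1 & C1); [lra|rewrite Rabs_pos_eq; lra|].
  destruct (V (- (e / 2))) as (s2 & E2 & S2 & C2); [lra|rewrite Rabs_Ropp, Rabs_pos_eq; lra|].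
  set (g0 := g (RtoC 0)) in *.
  pose proof (re_le_Cmod (g (RtoC (e / 2)) - g0)%C) as R1.
  pose proof (im_le_Cmod (g (RtoC (e / 2)) - g0)%C) as I1.
  pose proof (re_le_Cmod (g (RtoC (- (e / 2))) - g0)%C) as R2.
  rewrite E1 in R1, I1, C1. rewrite E2 in R2, C2.
  assert (Q1 : s1 / (e / 2) <= 0).
  { apply Rmult_le_reg_r with (e / 2); [lra|].
    replace (s1 / (e / 2) * (e / 2)) with s1 by (field; lra). lra. }
  assert (Q2 : 0 <= s2 / - (e / 2)).
  { apply Rmult_le_reg_r with (e / 2); [lra|].
    replace (s2 / - (e / 2) * (e / 2)) with (- s2) by (field; lra). lra. }
  pose proof (Cmod_le_re_im g0) as T.
  unfold Re, Im in *. simpl in R1, I1, R2.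
  revert R1 I1 R2 T. unfold Rabs. repeat destruct Rcase_abs; intros; lra.
Qed.

(** Both signs of [t] are included because the parity of an order of vanishing is read off from the
    two sides of 0. *)
Definition real_rooted (F : list (C -> C)) : Prop :=
  exists d, 0 < d /\ forall t, Rabs t < d -> forall z, mev (values F (RtoC t)) z = RtoC 0 -> Im z = 0.

Lemma real_of_roots L : (forall z, mev (of_roots L) z = RtoC 0 -> Im z = 0) ->
  forall z, In z L -> Im z = 0.
Proof. intros H z Hz. apply H. rewrite mev_of_roots. now apply prodl_root. Qed.

Lemma near_Forall (P : (C -> C) -> C -> Prop) F :
  Forall (fun f => near (P f)) F -> near (fun x => Forall (fun f => P f x) F).
Proof.
  induction 1; [apply near_all; constructor|].
  refine (near_mono _ _ _ (near_and _ _ H IHForall)). intros x' [? ?]. now constructor.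
Qed.

(* The roots of the Weierstrass polynomial tend to 0 with [x], so all of them lie in the
   neighbourhood where the zeros of the series are controlled. *)
Lemma weierstrass_real_rooted a M : conv2 a ->
  (forall j, (j < M)%nat -> a O j = RtoC 0) -> a O M <> RtoC 0 ->
  (exists d, 0 < d /\ forall (t : R) y, Rabs t < d -> Cmod y < d -> eval2 a (RtoC t) y = RtoC 0 -> Im y = 0) ->
  exists u F, conv2 u /\ u O O <> RtoC 0 /\ length F = M /\ Forall analytic F /\
    Forall (fun f => f (RtoC 0) = RtoC 0) F /\
    near2 (fun x y => eval2 a x y = eval2 u x y * mev (values F x) y)%C /\ real_rooted F.
Proof.
  intros Ha H0 HM (d & Hd & HZ).
  destruct (weierstrass_preparation a M Ha H0 HM) as (u & F & Hu & Hu0 & HL & HF & F0 & (e & He & E)).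
  exists u, F. repeat split; auto. { exists e. auto. }
  (* The 1 serves [Cmod_mev_ge], [d] the hypothesis on the zeros, [e] the factorization. *)
  set (r := Rmin 1 (Rmin d e)).
  assert (Hr : 0 < r <= 1 /\ r <= d /\ r <= e).
  { unfold r. pose proof (Rmin_pos d e Hd He). pose proof (Rmin_pos 1 (Rmin d e) ltac:(lra) H).
    pose proof (Rmin_l 1 (Rmin d e)). pose proof (Rmin_r 1 (Rmin d e)).
    pose proof (Rmin_l d e). pose proof (Rmin_r d e). lra. }
  assert (Hp : 0 < (r / 2) ^ M) by (apply pow_lt; lra).
  assert (S1 : near (fun x => Forall (fun f => Cmod (f x) < (r / 2) ^ M) F)).
  { apply (near_Forall (fun f x => Cmod (f x) < (r / 2) ^ M)). rewrite Forall_forall in *.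
    intros f Hf. refine (near_mono _ _ _ (analytic_continuous f (HF f Hf) _ Hp)).
    intros x Hx. rewrite (F0 f Hf) in Hx. now replace (f x - RtoC 0)%C with (f x) in Hx by ring. }
  destruct (near_and _ _ S1 (near_ball r ltac:(lra))) as (k & Hk & S2).
  exists k. split; [exact Hk|]. intros t Ht z Hz.
  destruct (S2 (RtoC t)) as [S3 S4]; [now rewrite Cmod_R|]. rewrite Cmod_R in S4.
  assert (Hzr : Cmod z < r).
  { destruct (Rlt_le_dec (Cmod z) r) as [|C]; [assumption|exfalso].
    pose proof (Cmod_mev_ge r M (values F (RtoC t)) z ltac:(lra) C) as X.
    rewrite length_values, HL, Hz, Cmod_0 in X. specialize (X (le_n _)).
    assert ((r / 2) ^ M <= 0); [|lra]. apply X. intros c Hc. unfold values in Hc.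
    apply in_map_iff in Hc. destruct Hc as (f & <- & Hf). rewrite Forall_forall in S3.
    left. now apply S3. }
  apply (HZ t z); [lra|lra|]. rewrite E, Hz; [ring|rewrite Cmod_R; lra|lra].
Qed.

(** The weights make the coefficient of [y^(n-k)] O(t^(mk)), so [x^(mk)] divides it; the quotients
    are the coefficients after [y = x^m z]. *)
Lemma values_scale (m : nat) K c F : Forall analytic F ->
  near_pos (fun t => weighted K (c * t ^ m) (values F (RtoC t))) ->
  exists G, Forall analytic G /\ length G = length F /\
    near (fun x => values F x = scale (x ^ m)%C (values G x)).
Proof.
  intros HF. induction HF as [|f F Hf HF IH]; intros HW.
  - exists nil. repeat split; [constructor|]. now apply near_all.
  - destruct IH as (G & HG & HL & E).
    { refine (near_pos_mono _ _ _ HW). intros t _ [_ Ht]. exact Ht. }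
    destruct (analytic_divide f (m * S (length F)) (K * c ^ S (length F)) Hf) as (g & Hg & Eg).
    { refine (near_pos_mono _ _ _ HW). intros t _ [Ht _].
      change (Cmod (f (RtoC t)) <= K * (c * t ^ m) ^ S (length (values F (RtoC t)))) in Ht.
      rewrite length_values in Ht.
      rewrite pow_mult, Rmult_assoc, <- Rpow_mult_distr. exact Ht. }
    exists (g :: G). split; [now constructor|]. split; [simpl; now rewrite HL|].
    refine (near_mono _ _ _ (near_and _ _ E Eg)). intros x [E1 E2].
    cbn [values map scale]. fold (values F x) (values G x). rewrite E1, E2, length_values, HL.
    now rewrite Cpow_mult_r.
Qed.

(** * Splitting of real-rooted families *)

Definition splits (F : list (C -> C)) : Prop :=
  exists Phi, length Phi = length F /\ Forall analytic Phi /\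
    near (fun x => forall y, mev (values F x) y = prodl (values Phi x) y).

Lemma Cpow_eq_0 z n : (z ^ n = RtoC 0)%C -> z = RtoC 0.
Proof. intros E. apply NNPP. intros N. exact (Cpow_nz z n N E). Qed.

Lemma mev_of_zero_coefs l : (forall j, (j < length l)%nat -> nth j (l ++ RtoC 1 :: nil) (RtoC 0) = RtoC 0) ->
  forall y, (mev l y = y ^ length l)%C.
Proof.
  intros H y. apply mev_all_0. intros j Hj.
  etransitivity; [symmetry; now apply app_nth1|now apply H].
Qed.

(* A nonreal root at [x = 0] would have distance at least its imaginary part from all the
   roots at [x <> 0], which are real. *)
Lemma real_rooted_limit G : Forall analytic G ->
  near_pos (fun t => forall z, mev (values G (RtoC t)) z = RtoC 0 -> Im z = 0) ->
  forall z, mev (values G (RtoC 0)) z = RtoC 0 -> Im z = 0.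
Proof.
  intros HG HR z Hz. apply NNPP. intros N.
  assert (P : 0 < Rabs (Im z) ^ length G) by (apply pow_lt; now apply Rabs_pos_lt).
  pose proof (analytic_continuous _ (analytic_mev G (fun _ => z) HG (analytic_const z)) _ P) as Q.
  destruct (near_pos_inhab _ (near_pos_and _ _ HR (near_near_pos _ Q))) as (t & Ht & Hr & Q').
  rewrite Hz in Q'. destruct (split_of_roots (values G (RtoC t))) as [L HL]. rewrite HL in Hr, Q'.
  replace (mev (of_roots L) z - RtoC 0)%C with (mev (of_roots L) z) in Q' by ring.
  rewrite mev_of_roots in Q'.
  pose proof (Cmod_prodl_ge L z (real_of_roots L Hr)) as X.
  replace (length L) with (length G) in X; [lra|].
  now rewrite <- (length_values G (RtoC t)), HL, length_of_roots.
Qed.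

(* A root with multiplicity less than the degree at [x = 0]: Weierstrass preparation there
   reduces to smaller degree. *)
Lemma root_of_distinct_roots G L :
  (forall F, (length F < length G)%nat -> Forall analytic F -> real_rooted F -> splits F) ->
  Forall analytic G -> real_rooted G -> (0 < length G)%nat ->
  values G (RtoC 0) = of_roots L -> ~ (exists z, forall w, In w L -> w = z) ->
  exists phi, analytic phi /\ near (fun x => mev (values G x) (phi x) = RtoC 0).
Proof.
  intros IH HG (d & Hd & HR) Hlen HL HD.
  assert (LL : length L = length G) by now rewrite <- (length_values G (RtoC 0)), HL, length_of_roots.
  destruct L as [|z0 L']; [simpl in LL; lia|]. set (L := z0 :: L') in *.
  assert (Hroot : forall w, In w L -> mev (values G (RtoC 0)) w = RtoC 0).
  { intros w Hw. rewrite HL, mev_of_roots. now apply prodl_root. }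
  assert (Hz0 : Im z0 = 0).
  { apply (HR 0); [rewrite Rabs_R0; exact Hd|]. apply Hroot. now left. }
  destruct (values_mshift (fun _ => z0) G HG (analytic_const z0)) as (H & HH & HHL & EH).
  assert (EH' : forall x y, mev (values H x) y = mev (values G x) (z0 + y)%C).
  { intros x y. rewrite EH. apply mev_mshift. }
  destruct (rows_of_polynomial H HH) as (a & Ha & a0 & (d1 & Hd1 & Ea)).
  assert (Nz : exists j, a O j <> RtoC 0).
  { exists (length (values H (RtoC 0))). rewrite a0, app_nth2, Nat.sub_diag by lia.
    apply RtoC_neq_0. lra. }
  (* [m] is the multiplicity of [z0] at [x = 0]: positive because [z0] is a root, less than the
     degree because the roots are not all equal. *)
  destruct (dec_inh_nat_subset_has_unique_least_element _ (fun n => classic _) Nz)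
      as (m & [Hm Hmin] & _).
  assert (Z : forall j, (j < m)%nat -> a O j = RtoC 0).
  { intros j Hj. apply NNPP. intros C. specialize (Hmin _ C). lia. }
  assert (m0 : (0 < m)%nat).
  { destruct m; [exfalso|lia]. apply Hm. rewrite a0.
    pose proof (EH' (RtoC 0) (RtoC 0)) as X. rewrite Cplus_0_r, Hroot in X by now left.
    destruct (values H (RtoC 0)) as [|c l] eqn:El.
    - rewrite <- (length_values H (RtoC 0)), El in HHL. simpl in HHL. lia.
    - simpl in X |- *. rewrite <- X. ring. }
  assert (mG : (m < length G)%nat).
  { destruct (Nat.lt_ge_cases m (length G)) as [|C]; [assumption|exfalso].
    apply HD. exists z0. intros w Hw.
    assert (X : mev (values H (RtoC 0)) (w - z0)%C = RtoC 0).
    { rewrite EH'. replace (z0 + (w - z0))%C with w by ring. now apply Hroot. }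
    rewrite mev_of_zero_coefs in X.
    - apply Cpow_eq_0 in X. replace w with ((w - z0) + z0)%C by ring. rewrite X. ring.
    - intros j Hj. rewrite <- a0. apply Z. rewrite length_values in Hj. lia. }
  destruct (weierstrass_real_rooted a m Ha Z Hm) as (u & F & Hu & _ & FL & HF & F0 & (d2 & Hd2 & Eu) & RF).
  (* As [z0] is real, the translation preserves imaginary parts. *)
  { exists (Rmin d d1). split; [now apply Rmin_pos|]. intros t y Ht Hy E.
    pose proof (Rmin_l d d1). pose proof (Rmin_r d d1).
    rewrite Ea, EH' in E by (rewrite ?Cmod_R; lra). apply (HR t) in E; [|lra].
    unfold Im in *. simpl in E. lra. }
  destruct (IH F ltac:(lia) HF RF) as (Phi & PL & HPhi & EPhi).
  destruct Phi as [|phi Phi]; [simpl in PL; lia|]. inversion HPhi as [|? ? Hphi _]; subst.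
  assert (R0 : near (fun x => mev (values F x) (phi x) = RtoC 0)).
  { refine (near_mono _ _ _ EPhi). intros x Ex. rewrite Ex. apply prodl_root. now left. }
  (* At [x = 0] the prepared polynomial is a power of [y]. By continuity [phi x] then stays in the
     region where both [Ea] and [Eu] hold. *)
  assert (P0 : phi (RtoC 0) = RtoC 0).
  { apply (Cpow_eq_0 _ (length (values F (RtoC 0)))). rewrite <- mev_all_0.
    - now apply near_at_0 in R0.
    - intros j Hj. rewrite Forall_forall in F0. rewrite length_values in Hj.
      etransitivity; [exact (map_nth (fun f => f (RtoC 0)) F (fun _ => RtoC 0) j)|].
      apply F0. now apply nth_In. }
  exists (fun x => z0 + phi x)%C. split; [apply analytic_plus; [apply analytic_const|exact Hphi]|].
  assert (D : 0 < Rmin d1 d2) by now apply Rmin_pos.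
  refine (near_mono _ _ _ (near_and _ _ R0 (near_and _ _ (near_ball _ D)
    (analytic_continuous _ Hphi _ D)))).
  intros x (Rx & Dx & Cx). rewrite P0 in Cx.
  replace (phi x - RtoC 0)%C with (phi x) in Cx by ring.
  pose proof (Rmin_l d1 d2). pose proof (Rmin_r d1 d2).
  rewrite <- EH', <- Ea, Eu, Rx by lra. ring.
Qed.

(** For centred roots the sum of squares is -2 times [coef 1], so this one analytic function
    controls the size of all roots and fixes the exponent of the rescaling. *)
Lemma root_of_centered F :
  (forall F', (length F' < length F)%nat -> Forall analytic F' -> real_rooted F' -> splits F') ->
  Forall analytic F -> real_rooted F -> (0 < length F)%nat ->
  (forall x, coef 0 (values F x) = RtoC 0) ->
  exists phi, analytic phi /\ near (fun x => mev (values F x) (phi x) = RtoC 0).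
Proof.
  intros IH HF (d & Hd & HR) Hlen C0.
  assert (Hrt : forall t, Rabs t < d -> exists L s, values F (RtoC t) = of_roots L /\ L <> nil /\
    (RtoC s = - (RtoC 2 * coef 1 (values F (RtoC t))))%C /\ 0 <= s /\
    (forall z, In z L -> Cmod z ^ 2 <= s) /\ length L = length F).
  { intros t Ht. destruct (split_of_roots (values F (RtoC t))) as [L HL].
    assert (Hre : forall z, In z L -> Im z = 0).
    { apply real_of_roots. rewrite <- HL. now apply HR. }
    assert (LL : length L = length F) by now rewrite <- (length_values F (RtoC t)), HL, length_of_roots.
    destruct (lsumsq_real L Hre) as (s & Es & Hs & B). exists L, s. repeat split; auto.
    - intros ->. simpl in LL. lia.
    - rewrite <- Es, lsumsq_of_roots, <- HL, C0. ring. }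
  pose proof (analytic_coef 1 F HF) as Hc2.
  destruct (analytic_order _ Hc2) as [Z|(n & g & Hg & N & E)].
  (* With a vanishing sum of squares all roots at small real [t] are 0, so the zero function is a
     root there and, by the identity theorem, near 0. *)
  { exists (fun _ => RtoC 0). split; [apply analytic_const|].
    apply (analytic_identity (fun x => mev (values F x) (RtoC 0))).
    - apply (analytic_mev F (fun _ => RtoC 0) HF (analytic_const _)).
    - refine (near_pos_mono _ _ _ (near_near_pos _ (near_and _ _ Z (near_ball d Hd)))).
      intros t Ht [Zt Hdt]. rewrite Cmod_R in Hdt.
      destruct (Hrt t Hdt) as (L & s & HL & NL & Es & Hs & B & _).
      rewrite Zt, Cmult_0_r, Copp_0 in Es. apply RtoC_inj in Es.
      rewrite HL, mev_of_roots. apply prodl_root.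
      destruct L as [|z L]; [congruence|]. specialize (B z (or_introl eq_refl)).
      left. apply Cmod_eq_0. pose proof (Cmod_ge_0 z). nra. }
  destruct E as (e & He & E).
  destruct (even_order g n (Rmin d e) Hg N ltac:(now apply Rmin_pos)) as [m ->].
  { intros t Ht. pose proof (Rmin_l d e). pose proof (Rmin_r d e).
    destruct (Hrt t ltac:(lra)) as (L & s & HL & NL & Es & Hs & _).
    (* [coef 1] is minus half of the sum of squares [s]. *)
    exists (- s / 2). split; [|lra]. rewrite <- E by (rewrite Cmod_R; lra).
    rewrite RtoC_div, RtoC_opp, Es by lra. field. }
  destruct Hg as [bg Hbg]. destruct (has_series_bounded _ _ Hbg) as (K & HK & BK).
  assert (Hg : analytic g) by now exists bg.
  (* Each root satisfies |z|^2 <= 2 K t^(2m); the square of [1 + 2 * K] exceeds [2 * K], which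
     avoids a square root. The factor [2 ^ length F] is that of [weighted_of_roots]. *)
  destruct (values_scale m (2 ^ length F) (1 + 2 * K) F HF) as (G & HG & GL & EG).
  { refine (near_pos_mono _ _ _ (near_near_pos _ (near_and _ _ BK
      (near_and _ _ (near_ball e He) (near_ball d Hd))))).
    intros t Ht (Bt & et & dt). rewrite Cmod_R in dt.
    destruct (Hrt t dt) as (L & s & HL & NL & Es & Hs & B & LL).
    rewrite HL, <- LL. assert (tm : 0 < t ^ m) by now apply pow_lt.
    apply weighted_of_roots; [apply Rmult_le_pos; lra|]. intros z Hz.
    specialize (B z Hz). pose proof (Cmod_ge_0 z).
    assert (Hs2 : s <= 2 * K * (t ^ m * t ^ m)).
    { rewrite <- (Rabs_pos_eq s Hs), <- Cmod_R, Es, Cmod_opp, Cmod_mult, E by exact et.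
      rewrite Cmod_mult, Cmod_pow, !Cmod_R.
      rewrite (Rabs_pos_eq 2), (Rabs_pos_eq t), pow_add by lra.
      replace (2 * K * (t ^ m * t ^ m)) with (2 * (t ^ m * t ^ m * K)) by ring.
      apply Rmult_le_compat_l; [lra|]. apply Rmult_le_compat_l; [|exact Bt].
      apply Rmult_le_pos; lra. }
    apply Rsqr_incr_0_var; [|apply Rmult_le_pos; lra]. unfold Rsqr.
    assert (Q : 0 < t ^ m * t ^ m) by now apply Rmult_lt_0_compat.
    replace ((1 + 2 * K) * t ^ m * ((1 + 2 * K) * t ^ m)) with
      ((1 + 2 * K) * (1 + 2 * K) * (t ^ m * t ^ m)) by ring.
    assert (2 * K * (t ^ m * t ^ m) <= (1 + 2 * K) * (1 + 2 * K) * (t ^ m * t ^ m)).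
    { apply Rmult_le_compat_r; nra. }
    simpl in B. lra. }
  destruct EG as (e2 & He2 & EG).
  assert (Xm : forall t, 0 < t -> (RtoC t ^ m)%C <> RtoC 0).
  { intros t Ht. apply Cpow_nz, RtoC_neq_0. lra. }
  assert (GR1 : forall t, t <> 0 -> Rabs t < Rmin d e2 -> forall z,
    mev (values G (RtoC t)) z = RtoC 0 -> Im z = 0).
  { intros t t0 Ht z Hz. pose proof (Rmin_l d e2). pose proof (Rmin_r d e2).
    assert (X : mev (values F (RtoC t)) (RtoC t ^ m * z)%C = RtoC 0).
    { rewrite EG, mev_scale, Hz by (rewrite Cmod_R; lra). ring. }
    apply (HR t) in X; [|lra]. rewrite <- RtoC_pow, im_scal_l in X.
    apply Rmult_integral in X. destruct X as [X|X]; [|exact X].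
    exfalso. exact (pow_nonzero t m t0 X). }
  assert (D : 0 < Rmin d e2) by now apply Rmin_pos.
  (* [GR1] cancels [t ^ m] and does not reach [t = 0]; the limit argument does. *)
  assert (GR0 : forall z, mev (values G (RtoC 0)) z = RtoC 0 -> Im z = 0).
  { apply real_rooted_limit; [exact HG|]. exists (Rmin d e2). split; [exact D|].
    intros t Ht. apply GR1; [lra|]. rewrite Rabs_pos_eq; lra. }
  (* For [t > 0] the powers of [t] cancel; the identity theorem carries this equality and the next
     one to 0. *)
  assert (GC0 : coef 0 (values G (RtoC 0)) = RtoC 0).
  { apply (near_at_0 (fun x => coef 0 (values G x) = RtoC 0)).
    apply analytic_identity; [now apply analytic_coef|]. exists e2. split; [exact He2|].
    intros t Ht. apply NNPP. intros C. pose proof (C0 (RtoC t)) as X.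
    rewrite EG, coef_scale in X by (rewrite Cmod_R, Rabs_pos_eq; lra).
    revert X. apply Cmult_neq_0; [|exact C]. rewrite Cpow_1_r. apply Xm. lra. }
  assert (GC1 : coef 1 (values G (RtoC 0)) = g (RtoC 0)).
  { enough (X : (coef 1 (values G (RtoC 0)) + (- RtoC 1) * g (RtoC 0) = RtoC 0)%C).
    { replace (g (RtoC 0)) with (coef 1 (values G (RtoC 0)) -
        (coef 1 (values G (RtoC 0)) + (- RtoC 1) * g (RtoC 0)))%C by ring. rewrite X. ring. }
    apply (near_at_0 (fun x => coef 1 (values G x) + (- RtoC 1) * g x = RtoC 0)%C).
    apply (analytic_identity (fun x => coef 1 (values G x) + (- RtoC 1) * g x)%C).
    - apply analytic_plus; [now apply analytic_coef|].
      apply analytic_mult; [apply analytic_const|exact Hg].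
    - exists (Rmin e e2). split; [now apply Rmin_pos|]. intros t Ht.
      pose proof (Rmin_l e e2). pose proof (Rmin_r e e2).
      assert (X1 : Cmod (RtoC t) < e) by (rewrite Cmod_R, Rabs_pos_eq; lra).
      assert (X2 : Cmod (RtoC t) < e2) by (rewrite Cmod_R, Rabs_pos_eq; lra).
      pose proof (E _ X1) as X. rewrite EG, coef_scale in X by exact X2.
      pose proof (Xm t ltac:(lra)) as Y.
      replace (coef 1 (values G (RtoC t))) with (g (RtoC t)); [ring|].
      rewrite Cpow_add_r in X. simpl in X. rewrite Cmult_1_r in X.
      apply NNPP. intros C. apply (Cmult_neq_0 _ _ (Cmult_neq_0 _ _ Y Y) (Cminus_eq_contra _ _ C)).
      replace (RtoC t ^ m * RtoC t ^ m * (g (RtoC t) - coef 1 (values G (RtoC t))))%C with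
        (RtoC t ^ m * RtoC t ^ m * g (RtoC t) -
         RtoC t ^ m * RtoC t ^ m * coef 1 (values G (RtoC t)))%C by ring.
      rewrite X. ring. }
  destruct (split_of_roots (values G (RtoC 0))) as [L HL].
  destruct (root_of_distinct_roots G L) as (phi & Hphi & Ephi); auto.
  - intros F' HF'. apply IH. lia.
  - exists (Rmin d e2). split; [exact D|]. intros t Ht.
    destruct (Req_dec t 0) as [->|t0]; [exact GR0|now apply GR1].
  - lia.
  (* Equal roots with sum 0 are all 0, and then so is their sum of squares, which is -2 g(0). *)
  - intros [z Hz]. apply N. rewrite <- GC1.
    pose proof (lsumsq_of_roots L) as X. rewrite <- HL, GC0 in X.
    assert (LL : length L = length F).
    { now rewrite <- GL, <- (length_values G (RtoC 0)), HL, length_of_roots. }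
    pose proof (coef0_of_roots L) as Y. rewrite <- HL, GC0, (lsum_all_eq L z Hz), LL in Y.
    assert (z = RtoC 0).
    { apply NNPP. intros C. apply (Cmult_neq_0 (RtoC (INR (length F))) z).
      - apply RtoC_neq_0. apply not_0_INR. lia.
      - exact C.
      - replace (RtoC (INR (length F)) * z)%C with (- - (RtoC (INR (length F)) * z))%C by ring.
        rewrite <- Y. ring. }
    subst z. rewrite (lsumsq_all_0 L Hz) in X.
    apply NNPP. intros C. apply (Cmult_neq_0 (RtoC 2) _ (RtoC_neq_0 2 ltac:(lra)) C).
    replace (RtoC 2 * coef 1 (values G (RtoC 0)))%C with
      (- (RtoC 0 * RtoC 0 - RtoC 2 * coef 1 (values G (RtoC 0))))%C by ring.
    rewrite <- X. ring.
  - exists (fun x => x ^ m * phi x)%C. split.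
    + apply analytic_mult; [apply analytic_pow|exact Hphi].
    + refine (near_mono _ _ _ (near_and _ _ Ephi (near_ball e2 He2))).
      intros x [Ex Hx]. rewrite EG, mev_scale, Ex by exact Hx. ring.
Qed.

Lemma lsum_real L : (forall z, In z L -> Im z = 0) -> Im (lsum L) = 0.
Proof.
  induction L as [|z L IH]; intros H; [reflexivity|].
  assert (Im z = 0) by (apply H; now left).
  assert (Im (lsum L) = 0) by (apply IH; intros w Hw; apply H; now right).
  unfold Im in *. simpl. fold (lsum L). lra.
Qed.

Theorem real_rooted_splits F : Forall analytic F -> real_rooted F -> splits F.
Proof.
  remember (length F) as n eqn:Hn. revert F Hn.
  induction n as [n IH] using lt_wf_ind. intros F Hn HF HR. subst n.
  destruct F as [|f F'].
  { exists nil. repeat split; [constructor|]. apply near_all. reflexivity. }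
  set (F := f :: F') in *. assert (HM : INR (length F) <> 0) by (apply not_0_INR; discriminate).
  (* The mean of the roots; [coef0_mshift] shows that translating by it makes [coef 0] vanish. *)
  set (psi := fun x => (RtoC (- / INR (length F)) * coef 0 (values F x))%C).
  assert (Hpsi : analytic psi).
  { apply analytic_mult; [apply analytic_const|now apply analytic_coef]. }
  destruct (values_mshift psi F HF Hpsi) as (G & HG & GL & EG).
  assert (EG' : forall x y, mev (values G x) y = mev (values F x) (psi x + y)%C).
  { intros x y. rewrite EG. apply mev_mshift. }
  destruct HR as (d & Hd & HR).
  assert (Hroot : exists phi, analytic phi /\ near (fun x => mev (values F x) (phi x) = RtoC 0)).
  { destruct (root_of_centered G) as (phi & Hphi & E).
    - intros F1 H1 H2 H3. apply (IH (length F1)); auto. rewrite <- GL. exact H1.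
    - exact HG.
    (* For real [t] the mean of the real roots is real, so the translated family is again
       real-rooted. *)
    - exists d. split; [exact Hd|]. intros t Ht z Hz. rewrite EG' in Hz.
      apply (HR t Ht) in Hz. replace (Im z) with (Im (psi (RtoC t) + z)%C - Im (psi (RtoC t))).
      2: { unfold Im. simpl. ring. }
      rewrite Hz. unfold psi. rewrite im_scal_l.
      destruct (split_of_roots (values F (RtoC t))) as [L HL].
      rewrite HL, coef0_of_roots. pose proof (HR t Ht) as X. rewrite HL in X.
      pose proof (lsum_real L (real_of_roots L X)) as Y. unfold Im in *. simpl. rewrite Y. ring.
    - rewrite GL. simpl. lia.
    - intros x. rewrite EG, coef0_mshift, length_values. unfold psi.
      rewrite RtoC_opp, RtoC_inv by exact HM. field. now apply RtoC_neq_0.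
    - exists (fun x => psi x + phi x)%C. split; [now apply analytic_plus|].
      refine (near_mono _ _ _ E). intros x Ex. now rewrite <- EG'. }
  destruct Hroot as (phi & Hphi & Ephi). inversion HF as [|? ? Hf HF']; subst.
  destruct (values_quot phi F' HF' Hphi) as (Q & HQ & QL & EQ).
  assert (D : near (fun x => forall y, mev (values F x) y = (y - phi x) * mev (values Q x) y)%C).
  { refine (near_mono _ _ _ Ephi). intros x Ex y.
    rewrite EQ, <- (mev_quot (f x) (values F' x)).
    change (f x :: values F' x) with (values F x). rewrite Ex. ring. }
  destruct (IH (length Q)) with (F := Q) as (Phi & PL & HPhi & EPhi); auto.
  - rewrite QL. simpl. lia.
  - destruct D as (e & He & D). exists (Rmin d e). split; [now apply Rmin_pos|].
    intros t Ht z Hz. pose proof (Rmin_l d e). pose proof (Rmin_r d e).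
    apply (HR t); [lra|]. rewrite D, Hz by (rewrite Cmod_R; lra). ring.
  - exists (phi :: Phi). split; [simpl; now rewrite PL, QL|]. split; [now constructor|].
    refine (near_mono _ _ _ (near_and _ _ D EPhi)). intros x [Dx Ex] y.
    rewrite Dx, Ex. reflexivity.
Qed.

(** * Real coefficients of the roots and the final factorization *)

Lemma evalR1_0 b : convR1 b -> evalR1 b (RtoC 0) = RtoC (b O).
Proof.
  intros (r & K & Hr & H). apply (has_series_0 (fun n => RtoC (b n)) (evalR1 b)).
  exists r. split; [exact Hr|]. apply (has_series_of_bound _ r K Hr).
  intros n. rewrite Cmod_R. apply H.
Qed.

Lemma Cprod_S n f : (Cprod (S n) f = f O * Cprod n (fun j => f (S j)))%C.
Proof. unfold Cprod. cbn [seq map fold_right]. now rewrite <- seq_shift, map_map. Qed.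

Lemma prodl_Cprod Phi :
  Forall (fun f => exists b, convR1 b /\ b O = 0 /\ near (fun x => f x = evalR1 b x)) Phi ->
  exists phi : nat -> nat -> R,
    (forall j, (j < length Phi)%nat -> convR1 (phi j) /\ phi j O = 0) /\
    near (fun x => forall y,
      prodl (values Phi x) y = Cprod (length Phi) (fun j => y - evalR1 (phi j) x)%C).
Proof.
  induction 1 as [|f Phi (b & Hb & b0 & E) HPhi (phi & Hphi & IH)].
  - exists (fun _ _ => 0). split; [simpl; lia|]. now apply near_all.
  - exists (fun j => match j with O => b | S j' => phi j' end). split.
    + intros [|j] Hj; [auto|]. apply Hphi. simpl in Hj. lia.
    + refine (near_mono _ _ _ (near_and _ _ E IH)). intros x [E1 E2] y.
      cbn [length]. rewrite Cprod_S, <- E2, <- E1. reflexivity.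
Qed.

Theorem theorem3p2 (a : nat -> nat -> C) :
  conv2 a ->
  a 0%nat 0%nat = RtoC 0 ->
  (exists j, a 0%nat j <> RtoC 0) ->
  (exists eps : R, 0 < eps /\
     forall (x : R) (y : C), Rabs x < eps -> Cmod y < eps -> Im y <> 0 ->
       eval2 a (RtoC x) y <> RtoC 0) ->
  forall M : nat,
    (forall j, (j < M)%nat -> a 0%nat j = RtoC 0) -> a 0%nat M <> RtoC 0 ->
    exists (u : nat -> nat -> C) (phi : nat -> nat -> R),
      conv2 u /\ u 0%nat 0%nat <> RtoC 0 /\
      (forall j, (j < M)%nat -> convR1 (phi j) /\ phi j 0%nat = 0) /\
      exists delta : R, 0 < delta /\
        forall x y : C, Cmod x < delta -> Cmod y < delta ->
          eval2 a x y =
          (eval2 u x y * Cprod M (fun j => (y - evalR1 (phi j) x)%C))%C.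
Proof.
  intros Ha _ _ (eps & Heps & HZ) M H0 HM.
  destruct (weierstrass_real_rooted a M Ha H0 HM) as (u & F & Hu & Hu0 & FL & HF & F0 & Eu & RF).
  { exists eps. split; [exact Heps|]. intros t y Ht Hy E. apply NNPP. intros C.
    exact (HZ t y Ht Hy C E). }
  destruct (real_rooted_splits F HF RF) as (Phi & PL & HPhi & EPhi).
  (* Each [f] in [Phi] is a root of the real-rooted [F], hence real on the real axis, as
     [analytic_real] requires. *)
  assert (R0 : near (fun x => forall f, In f Phi -> mev (values F x) (f x) = RtoC 0)).
  { refine (near_mono _ _ _ EPhi). intros x Ex f Hf. rewrite Ex. apply prodl_root.
    exact (in_map (fun f => f x) _ _ Hf). }
  destruct (prodl_Cprod Phi) as (phi & Hphi & E2).
  { rewrite Forall_forall in *. intros f Hf.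
    destruct (analytic_real f (HPhi f Hf)) as (b & Hb & Eb).
    - destruct RF as (d & Hd & RF).
      refine (near_pos_mono _ _ _ (near_near_pos _ (near_and _ _ R0 (near_ball d Hd)))).
      intros t _ [Rt Dt]. rewrite Cmod_R in Dt. apply (RF t Dt). now apply Rt.
    (* The coefficients of [F] vanish at 0, so the polynomial is [y^M] there and each root starts at
       0. *)
    - exists b. repeat split; auto. apply RtoC_inj. rewrite <- (evalR1_0 b Hb).
      apply near_at_0 in Eb. rewrite <- Eb. apply (Cpow_eq_0 _ (length (values F (RtoC 0)))).
      rewrite <- mev_all_0; [now apply near_at_0 in R0; apply R0|].
      intros j Hj. rewrite length_values in Hj.
      etransitivity; [exact (map_nth (fun f => f (RtoC 0)) F (fun _ => RtoC 0) j)|].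
      apply F0. now apply nth_In. }
  rewrite PL, FL in Hphi, E2. exists u, phi. repeat split; auto; try now apply Hphi.
  destruct (near2_and _ _ Eu (near_near2 _ (near_and _ _ EPhi E2))) as (delta & Hdelta & E).
  exists delta. split; [exact Hdelta|]. intros x y Hx Hy.
  destruct (E x y Hx Hy) as (-> & E3 & E4). now rewrite E3, E4.
Qed.
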